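(* Fix integers $d,k\ge 2$ and a symmetric concave sequence $h_0,\dots,h_k$. There is a function $\Phi:[0,\infty)\to\mathbb{R}$ (depending only on $d,k$ and $h$) such that for every large girth sequence $G_1,G_2,\dots$ of finite $(d,k)$-biregular factor graphs and every $\beta\ge 0$, \[\lim_{n\to\infty}\Phi_{G_n}(\beta)=\Phi(\beta).\]
   Context: A $(d,k)$-biregular factor graph is a finite bipartite graph $G$ with color classes $V$ (variable nodes) and $F$ (factor nodes) such that every variable node has degree $d$ and every factor node has degree $k$. The sequence $h_0,\dots,h_k$ (also written $h(i)$) is symmetric concave: $h_i=h_{k-i}$ for $0\le i\le k$ and $2h_i\ge h_{i-1}+h_{i+1}$ for $1\le i\le k-1$. For $x\in\{0,1\}^V$ set $H_G(x)=\sum_{f\in F} h\left(\sum_{v\in\partial f}x_v\right)$, where $\partial f$ is the set of neighbors of $f$. For $\beta\ge0$ let $Z_G(\beta)=\sum_{x\in\{0,1\}^V}\exp(-\beta H_G(x))$ and $\Phi_G(\beta)=\frac{\log Z_G(\beta)}{|V|}$ (the free energy density). A sequence of finite graphs has large girth if the length of its shortest cycle tends to infinity. *)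

(* Defs.v *)
From HB Require Import structures.
From mathcomp Require Import all_boot all_order all_algebra.
From mathcomp Require Import all_classical all_reals all_analysis.

Set Implicit Arguments.
Unset Strict Implicit.
Unset Printing Implicit Defensive.

Import Order.TTheory GRing.Theory Num.Theory.
Import numFieldNormedType.Exports.

Local Open Scope classical_set_scope.
Local Open Scope ring_scope.

(* A finite simple bipartite graph, given by its two colour classes and the
   incidence relation between them. *)
Record factor_graph := FactorGraph {
  vnode : finType;
  fnode : finType;
  incident : vnode -> fnode -> bool }.

Definition vnbhd (G : factor_graph) (v : vnode G) : {set fnode G} :=
  [set f | incident v f]%SET.

Definition fnbhd (G : factor_graph) (f : fnode G) : {set vnode G} :=
  [set v | incident v f]%SET.

(* Graphs are nonempty: otherwise the free energy density would be 0 / 0. *)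
Definition biregular (d k : nat) (G : factor_graph) : Prop :=
  [/\ (0 < #|vnode G|)%N,
      forall v : vnode G, #|vnbhd v| = d &
      forall f : fnode G, #|fnbhd f| = k].

Definition adjacent (G : factor_graph) : rel (vnode G + fnode G) :=
  fun a b => match a, b with
    | inl v, inr f => incident v f
    | inr f, inl v => incident v f
    | _, _ => false
    end.

(* [ucycle] also accepts the empty sequence and a single edge traversed back
   and forth, hence the lower bound on the length. *)
Definition graph_cycle (G : factor_graph) (c : seq (vnode G + fnode G)) : Prop :=
  ucycle (@adjacent G) c /\ (3 <= size c)%N.

(* The girth of an acyclic graph is +oo, as the infimum of the empty set. *)
Definition girth (R : realType) (G : factor_graph) : \bar R :=
  ereal_inf [set (size c)%:R%:E | c in @graph_cycle G].

Definition large_girth (R : realType) (G : nat -> factor_graph) : Prop :=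
  girth R (G n) @[n --> \oo] --> (+oo)%E.

(* Only the values h 0, ..., h k are constrained, and only these matter when
   every factor node has degree k. *)
Definition symmetric_concave (R : realType) (k : nat) (h : nat -> R) : Prop :=
  (forall i : nat, (i <= k)%N -> h i = h (k - i)%N) /\
  (forall i : nat, (1 <= i <= k - 1)%N -> h (i - 1)%N + h (i + 1)%N <= 2 * h i).

Definition energy (R : realType) (h : nat -> R) (G : factor_graph)
    (x : {ffun vnode G -> bool}) : R :=
  \sum_(f : fnode G) h (\sum_(v in fnbhd f) x v)%N.

Definition partition_function (R : realType) (h : nat -> R)
    (G : factor_graph) (beta : R) : R :=
  \sum_(x : {ffun vnode G -> bool}) expR (- beta * energy h x).

Definition free_energy_density (R : realType) (h : nat -> R)
    (G : factor_graph) (beta : R) : R :=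
  ln (partition_function h G beta) / #|vnode G|%:R.

(* Main.v *)
(** Write [w i = exp (- beta * h i)].  Concavity of [h] makes the Gibbs weight
    log-supermodular, so that FKG and the four functions theorem apply (also to
    marginals and to conditional measures).  The limit is the Bethe free energy,
    the supremum over densities [s] of
      inf_t (d/k) (ln (sum_i C(k,i) w_i e^(it)) - k t s) - (d-1) H(s).

    Lower bound, for every biregular graph.  Cut the edges one at a time.
    If [M] is a positive 2x2 matrix with [det M >= 0], its trace is at least the
    total mass of [M] reweighted by suitable fields on its two sides, divided by
    [exp (H(s) + s * (sum of the fields))]: choose the fields balancing the
    off-diagonal entries and use the arithmetic-geometric mean inequality.  Once
    everything is cut, convexity replaces the fields on a factor by their mean.

    Upper bound, for large girth.  Reveal the spins of j uniformly sampled
    vertices.  The sample mean estimates the total magnetization, so the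
    conditional covariances sum to at most n^2/j on average, and they drop by the
    squares of the influences as j grows.  By FKG and the Markov property the
    influence of a vertex on another one at distance more than l is at most
    (influence / l)^(1/2); hence the mutual information between far vertices is
    negligible.  Revealing one more vertex v changes the difference between the
    Bethe entropy and the true conditional entropy by a combination of mutual
    informations with v which, on the ball around v (a tree), has a sign: each
    factor near v dominates its vertex closest to v.  Summing over the
    steps bounds the entropy of the Gibbs measure, given a small sample, by its
    Bethe entropy.  The Gibbs variational principle and supermodularity bound the
    resulting Bethe functional by its value at homogeneous marginals. *)

Require Import Defs.
From HB Require Import structures.
From mathcomp Require Import all_boot all_order all_algebra.
From mathcomp Require Import all_classical all_reals all_analysis.
From mathcomp Require Import fintype finset ring lra zify.

Set Implicit Arguments.
Unset Strict Implicit.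
Unset Printing Implicit Defensive.

Import Order.TTheory GRing.Theory Num.Theory.
Import numFieldNormedType.Exports.

Local Open Scope ring_scope.

(** * Four functions theorem *)

Section FourFunctions.
Context {R : realFieldType} {T : finType}.
Implicit Types (A B X Y : {set T}) (v : T).

Lemma sum_subsetU1 (M : nmodType) v X (phi : {set T} -> M) : v \notin X ->
  \sum_(A : {set T} | A \subset v |: X) phi A =
  \sum_(A : {set T} | A \subset X) (phi A + phi (v |: A)).
Proof.
move=> vX; rewrite big_split /= (bigID (fun A : {set T} => v \in A)) /= addrC; congr +%R.
- apply: eq_bigl => A; apply/andP/idP => [[/subsetP AvX vA]|AX].
  + apply/subsetP => u uA; move: (AvX u uA); rewrite !inE => /orP[/eqP uv|//].
    by rewrite -uv uA in vA.
  + by split; [exact: subset_trans AX (subsetUr _ _)|apply: contra vX; apply/subsetP].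
- rewrite (reindex_onto (fun A : {set T} => v |: A) (fun A => A :\ v)) /=; last first.
    by move=> A /andP[_ vA]; rewrite setD1K.
  apply: eq_bigl => A; rewrite setU11 andbT; apply/andP/idP => [[AvX /eqP EA]|AX].
  + apply/subsetP => u uA; have := subsetP AvX u; rewrite !inE uA orbT => /(_ isT).
    by case/orP => // /eqP uv; move: uA; rewrite -EA uv !inE eqxx.
  + split; first exact: setUS.
    apply/eqP; rewrite setU1K //; apply: contra vX; exact/subsetP.
Qed.

(** Put [M = c1 * e0]. Both mixed products [a0 * b1] and [a1 * b0] are at most [M], so
    [(M - a0 * b1) * (M - a1 * b0) >= 0], while multiplying the two pure hypotheses bounds their
    product by [M * (c0 * e1)]. Dividing by [M] bounds their sum by [M + c0 * e1]. *)
Lemma two_point_four_functions (a0 a1 b0 b1 c0 c1 e0 e1 : R) :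
  0 <= a0 -> 0 <= a1 -> 0 <= b0 -> 0 <= b1 ->
  0 <= c0 -> 0 <= c1 -> 0 <= e0 -> 0 <= e1 ->
  a0 * b0 <= c0 * e0 -> a0 * b1 <= c1 * e0 ->
  a1 * b0 <= c1 * e0 -> a1 * b1 <= c1 * e1 ->
  (a0 + a1) * (b0 + b1) <= (c0 + c1) * (e0 + e1).
Proof.
move=> a00 a10 b00 b10 c00 c10 e00 e10 h00 h01 h10 h11.
have : a0 * b1 + a1 * b0 <= c1 * e0 + c0 * e1; last by lra.
have [M0|M0] := eqVneq (c1 * e0) 0.
  have : 0 <= c0 * e1 by exact: mulr_ge0.
  by lra.
have Mp : 0 < c1 * e0 by rewrite lt_def M0 mulr_ge0.
rewrite -(ler_pM2l Mp) -subr_ge0.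
have : 0 <= (c1 * e0 - a0 * b1) * (c1 * e0 - a1 * b0).
  by apply: mulr_ge0; rewrite subr_ge0.
have : (a0 * b0) * (a1 * b1) <= (c0 * e0) * (c1 * e1).
  by apply: ler_pM => //; apply: mulr_ge0.
by lra.
Qed.

(** The Ahlswede-Daykin inequality. Summing out one element [v] of [X] gives four functions on the
    subsets of [X :\ v] which satisfy the same hypothesis, by the two-point case. *)
Lemma four_functions X (a b c e : {set T} -> R) :
  (forall A, 0 <= a A) -> (forall A, 0 <= b A) ->
  (forall A, 0 <= c A) -> (forall A, 0 <= e A) ->
  (forall A B, A \subset X -> B \subset X ->
     a A * b B <= c (A :|: B) * e (A :&: B)) ->
  (\sum_(A : {set T} | A \subset X) a A) * (\sum_(A : {set T} | A \subset X) b A) <=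
  (\sum_(A : {set T} | A \subset X) c A) * (\sum_(A : {set T} | A \subset X) e A).
Proof.
have [n] := ubnP #|X|; elim: n X a b c e => // n IH X a b c e.
rewrite ltnS => Xn a0 b0 c0 e0 H.
have [->|[v vX]] := set_0Vmem X.
  have E (phi : {set T} -> R) : \sum_(A : {set T} | A \subset set0) phi A = phi set0.
    by under eq_bigl do rewrite subset0; rewrite big_pred1_eq.
  by rewrite !E; have := H _ _ (sub0set X) (sub0set X); rewrite setU0 setI0.
have vXv : v \notin X :\ v by rewrite !inE eqxx.
have EX : X = v |: (X :\ v) by rewrite setD1K.
rewrite [in X in X * _]EX [in X in _ * X]EX.
rewrite [in X in _ <= X * _]EX [in X in _ <= _ * X]EX.
rewrite !sum_subsetU1 //; apply: IH.
- by apply: leq_trans Xn; rewrite [X in (_ < X)%N](cardsD1 v) vX.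
- by move=> A; exact: addr_ge0.
- by move=> A; exact: addr_ge0.
- by move=> A; exact: addr_ge0.
- by move=> A; exact: addr_ge0.
move=> A B AX BX.
have vA : v \notin A by apply: contra vXv; apply/subsetP.
have vB : v \notin B by apply: contra vXv; apply/subsetP.
have AX' : A \subset X by apply: subset_trans AX (subsetDl _ _).
have BX' : B \subset X by apply: subset_trans BX (subsetDl _ _).
have vAX : v |: A \subset X by rewrite subUset sub1set vX.
have vBX : v |: B \subset X by rewrite subUset sub1set vX.
apply: two_point_four_functions => //; first exact: H.
- have := H _ _ AX' vBX; congr (_ <= c _ * e _).
  + by rewrite setUCA.
  + rewrite setIUr (_ : A :&: [set v] = set0) ?set0U //.
    by apply/setP => x; rewrite !inE; apply/andP => -[xA /eqP xv]; rewrite -xv xA in vA.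
- have := H _ _ vAX BX'; congr (_ <= c _ * e _).
  + by rewrite setUA.
  + rewrite setIUl (_ : [set v] :&: B = set0) ?set0U //.
    by apply/setP => x; rewrite !inE; apply/andP => -[/eqP xv xB]; rewrite -xv xB in vB.
- have := H _ _ vAX vBX; congr (_ <= c _ * e _).
  + by rewrite [RHS]setUUr.
  + by rewrite [RHS]setUIr.
Qed.

End FourFunctions.

(** * Decoupling log-supermodular weights *)

Section Logarithms.
Context {R : realType}.
Implicit Types (x y s a b : R).

Lemma expR_ln x : 0 < x -> expR (ln x) = x.
Proof. by move=> x0; rewrite lnK// posrE. Qed.

Lemma ln_prod_pos x y : 0 < x -> 0 < y -> ln (x * y) = ln x + ln y.
Proof. by move=> x0 y0; rewrite lnM// posrE. Qed.

Lemma ln_div_pos x y : 0 < x -> 0 < y -> ln (x / y) = ln x - ln y.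
Proof. by move=> x0 y0; rewrite ln_div// posrE. Qed.

Lemma ln_le_sub1 x : 0 < x -> ln x <= x - 1.
Proof.
move=> x0; have -> : ln x = ln (1 + (x - 1)) by congr ln; ring.
by apply: le_ln1Dx; lra.
Qed.

Lemma ln_le_mono x y : 0 < x -> x <= y -> ln x <= ln y.
Proof. by move=> x0 xy; rewrite ler_ln// posrE ?(lt_le_trans x0). Qed.

Definition entropy2 s : R := - (s * ln s) - (1 - s) * ln (1 - s).

(** The bound [ln x <= x - 1] is applied to the ratios of the Gibbs weights to [1 - s] and [s]; the
    averaged right-hand sides sum to zero. *)
Lemma gibbs_two_point s a b : 0 < s < 1 -> 0 < a -> 0 < b ->
  (1 - s) * ln a + s * ln b + entropy2 s <= ln (a + b).
Proof.
move=> /andP[s0 s1] a0 b0; rewrite /entropy2.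
have ab : 0 < a + b by lra.
have s1' : 0 < 1 - s by lra.
have h1 : ln (a / (1 - s) / (a + b)) <= a / (1 - s) / (a + b) - 1.
  by apply: ln_le_sub1; rewrite !divr_gt0.
have h2 : ln (b / s / (a + b)) <= b / s / (a + b) - 1.
  by apply: ln_le_sub1; rewrite !divr_gt0.
have e1 : ln (a / (1 - s) / (a + b)) = ln a - ln (1 - s) - ln (a + b).
  by rewrite !ln_div_pos ?divr_gt0.
have e2 : ln (b / s / (a + b)) = ln b - ln s - ln (a + b).
  by rewrite !ln_div_pos ?divr_gt0.
have k1 := ler_wpM2l (ltW s1') h1; have k2 := ler_wpM2l (ltW s0) h2.
have E : (1 - s) * (a / (1 - s) / (a + b) - 1) + s * (b / s / (a + b) - 1) = 0.
  by field; rewrite !gt_eqF.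
rewrite e1 in k1; rewrite e2 in k2; lra.
Qed.

Lemma entropy2_ge0 s : 0 <= s <= 1 -> 0 <= entropy2 s.
Proof.
move=> /andP[s0 s1]; rewrite /entropy2.
have h1 : ln s <= 0 by apply: ln_le0.
have h2 : ln (1 - s) <= 0 by apply: ln_le0; lra.
have := mulr_ge0 s0 (_ : 0 <= - ln s); have := @mulr_ge0 _ (1 - s) (- ln (1 - s)).
by move=> k1 k2; have := k1 ltac:(lra) ltac:(lra); have := k2 ltac:(lra); lra.
Qed.

(** An edge forces two copies of a spin to agree and so keeps only the diagonal mass [F00 + F11].
    Cutting it frees the copies, at the price of a field on each. *)
Lemma one_edge s (F00 F10 F01 F11 : R) : 0 < s < 1 ->
  0 < F00 -> 0 < F10 -> 0 < F01 -> 0 < F11 -> F01 * F10 <= F00 * F11 ->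
  exists eta theta : R,
    F00 + F10 * expR eta + F01 * expR theta + F11 * expR (eta + theta) <=
    (F00 + F11) * expR (s * (eta + theta) + entropy2 s).
Proof.
move=> s01 p00 p10 p01 p11 hF; have /andP[s0 s1] := s01.
have s1' : 0 < 1 - s by lra.
pose x := s / (1 - s); have x0 : 0 < x by rewrite divr_gt0.
have lx : ln x = ln s - ln (1 - s) by rewrite ln_div_pos.
(* The sum [rho] of the fields makes the last term equal to [F00 * x ^+ 2], and its division into
   [eta] and [theta] makes the two off-diagonal terms equal, hence at most [F00 * x] by the
   determinant condition. The total is then at most [F00 * (1 + x) ^+ 2]. *)
pose rho := 2 * ln x + ln F00 - ln F11.
pose eta := (rho + ln F01 - ln F10) / 2.
pose theta := (rho + ln F10 - ln F01) / 2.
have sumE : eta + theta = rho by rewrite /eta /theta; lra.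
exists eta, theta.
have lnF : ln F01 + ln F10 <= ln F00 + ln F11.
  by rewrite -!ln_prod_pos//; apply: ln_le_mono hF; rewrite mulr_gt0.
have h10 : F10 * expR eta <= F00 * x.
  rewrite -{1}(expR_ln p10) -expRD -[X in _ <= X](expR_ln (mulr_gt0 p00 x0)).
  by rewrite ler_expR (ln_prod_pos p00 x0) /eta /rho; lra.
have h01 : F01 * expR theta <= F00 * x.
  rewrite -{1}(expR_ln p01) -expRD -[X in _ <= X](expR_ln (mulr_gt0 p00 x0)).
  by rewrite ler_expR (ln_prod_pos p00 x0) /theta /rho; lra.
have h11 : F11 * expR (eta + theta) = F00 * (x * x).
  rewrite sumE -{1}(expR_ln p11) -expRD -[RHS](expR_ln (mulr_gt0 p00 (mulr_gt0 x0 x0))).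
  by congr expR; rewrite (ln_prod_pos p00 (mulr_gt0 x0 x0)) (ln_prod_pos x0 x0) /rho; lra.
have xE : F00 + F00 * x + F00 * x + F00 * (x * x) = F00 / (1 - s) / (1 - s).
  by rewrite /x; field; rewrite gt_eqF.
have key : F00 + F10 * expR eta + F01 * expR theta + F11 * expR (eta + theta) <=
    F00 / (1 - s) / (1 - s).
  by rewrite -xE h11; lra.
apply: le_trans key _.
have Fp : 0 < F00 + F11 by lra.
rewrite -{1}(expR_ln Fp) -expRD -[X in X <= _]expR_ln ?divr_gt0//.
rewrite ler_expR !ln_div_pos ?divr_gt0// sumE /rho lx.
have := gibbs_two_point s01 p00 p11; rewrite /entropy2 => h; lra.
Qed.

End Logarithms.

(** * Log-supermodular set functions *)

Section LogSupermodular.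
Context {R : realType} {T : finType}.
Implicit Types (A B X Y : {set T}) (v : T) (w : nat -> R).

Definition log_supermodular (q : {set T} -> R) :=
  forall A B, q A * q B <= q (A :|: B) * q (A :&: B).

Definition log_convex_upto k w :=
  (forall i, (i <= k)%N -> 0 < w i) /\
  (forall i, (i.+2 <= k)%N -> w i.+1 * w i.+1 <= w i * w i.+2).

(** Log-convexity makes the ratios [w i.+1 / w i] nondecreasing; this compares the ratios at [x] and
    [x + b], cross-multiplied. *)
Lemma log_convex_ratio k w x b : log_convex_upto k w -> (x + b.+1 <= k)%N ->
  w x.+1 * w (x + b)%N <= w x * w (x + b.+1)%N.
Proof.
move=> [wp wc]; elim: b => [|b IH] xk; first by rewrite addn0 addn1 mulrC.
have {}IH := IH ltac:(lia).
have cx : w (x + b.+1)%N * w (x + b.+1)%N <= w (x + b)%N * w (x + b.+2)%N.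
  by have := wc (x + b)%N; rewrite !addnS; apply; lia.
have p0 : 0 < w (x + b)%N by apply: wp; lia.
have p1 : 0 < w (x + b.+1)%N by apply: wp; lia.
have p2 : 0 < w x.+1 by apply: wp; lia.
have p3 : 0 < w x by apply: wp; lia.
rewrite -(ler_pM2l (mulr_gt0 p0 p1)).
have := ler_pM (mulr_ge0 (ltW p2) (ltW p0)) (mulr_ge0 (ltW p1) (ltW p1)) IH cx.
lra.
Qed.

Lemma log_convex_exchange k w x a b : log_convex_upto k w -> (x + a + b <= k)%N ->
  w (x + a)%N * w (x + b)%N <= w x * w (x + a + b)%N.
Proof.
move=> wlc; have [wp _] := wlc; elim: a => [|a IH] xk; first by rewrite addn0.
have {}IH := IH ltac:(lia).
have := @log_convex_ratio k w (x + a) b wlc ltac:(lia) => h.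
have p0 : 0 < w (x + a)%N by apply: wp; lia.
have p1 : 0 < w (x + a + b)%N by apply: wp; lia.
have p2 : 0 < w (x + a).+1 by apply: wp; lia.
have p3 : 0 < w (x + b)%N by apply: wp; lia.
rewrite !addnS addSn; rewrite addnS in h.
rewrite -(ler_pM2l (mulr_gt0 p0 p1)).
have := ler_pM (mulr_ge0 (ltW p0) (ltW p3)) (mulr_ge0 (ltW p2) (ltW p1)) IH h.
lra.
Qed.

Lemma log_supermodular_card k w X : log_convex_upto k w -> (#|X| <= k)%N ->
  log_supermodular (fun A => w #|A :&: X|).
Proof.
move=> wlc Xk A B; set A' := A :&: X; set B' := B :&: X.
have -> : (A :|: B) :&: X = A' :|: B' by rewrite setIUl.
have -> : A :&: B :&: X = A' :&: B' by rewrite /A' /B' setIACA setIid.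
have AB := cardsUI A' B'.
have h1 : (#|A' :&: B'| <= #|A'|)%N by apply/subset_leq_card/subsetIl.
have h2 : (#|A' :&: B'| <= #|B'|)%N by apply/subset_leq_card/subsetIr.
have h3 : (#|A' :|: B'| <= k)%N.
  by apply: leq_trans Xk; apply: subset_leq_card; rewrite subUset !subsetIr.
have := @log_convex_exchange k w #|A' :&: B'| (#|A'| - #|A' :&: B'|)
  (#|B'| - #|A' :&: B'|) wlc ltac:(lia).
rewrite [X in _ <= X]mulrC; congr (w _ * w _ <= w _ * _); lia.
Qed.

Lemma log_supermodularM q1 q2 : (forall A, 0 <= q1 A) -> (forall A, 0 <= q2 A) ->
  log_supermodular q1 -> log_supermodular q2 ->
  log_supermodular (fun A => q1 A * q2 A).
Proof.
move=> p1 p2 h1 h2 A B; rewrite mulrACA [X in _ <= X]mulrACA.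
by apply: ler_pM => //; apply: mulr_ge0.
Qed.

Lemma log_supermodular_prod (I : Type) (r : seq I) (q : I -> {set T} -> R) :
  (forall i A, 0 <= q i A) -> (forall i, log_supermodular (q i)) ->
  log_supermodular (fun A => \prod_(i <- r) q i A).
Proof.
move=> p h A B; rewrite -!big_split /=; apply: ler_prod => i _.
by rewrite mulr_ge0//=; exact: h.
Qed.

(** The exponent is modular in [A], so equality holds. *)
Lemma log_supermodular_field (th : T -> R) :
  log_supermodular (fun A => expR (\sum_(v in A) th v)).
Proof.
move=> A B; rewrite -!expRD ler_expR le_eqVlt; apply/orP; left; apply/eqP.
by rewrite [RHS]addrC (big_setID A (A := A :|: B)) /= setUK setDUl setDv set0U
  addrCA [in RHS]setIC -(big_setID A).
Qed.

Lemma setI_U1r A B v : v \notin A -> A :&: (v |: B) = A :&: B.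
Proof.
move=> vA; apply/setP => x; rewrite !inE.
by case: eqP => [->|//]; rewrite (negbTE vA).
Qed.

Lemma setI_U1l A B v : v \notin B -> (v |: A) :&: B = A :&: B.
Proof. by move=> vB; rewrite setIC setI_U1r// setIC. Qed.

(** Summing out a spin in a field preserves log-supermodularity, again by the two-point case. This
    keeps the induction of [decouple] going. *)
Lemma log_supermodular_sum1 (q : {set T} -> R) X v c : 0 <= c -> v \notin X ->
  (forall A, 0 < q A) ->
  (forall A B, A \subset v |: X -> B \subset v |: X ->
    q A * q B <= q (A :|: B) * q (A :&: B)) ->
  forall A B, A \subset X -> B \subset X ->
    (q A + c * q (v |: A)) * (q B + c * q (v |: B)) <=
    (q (A :|: B) + c * q (v |: (A :|: B))) * (q (A :&: B) + c * q (v |: (A :&: B))).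
Proof.
move=> c0 vX qp qs A B AX BX.
have vA : v \notin A by apply: contra vX; apply/subsetP.
have vB : v \notin B by apply: contra vX; apply/subsetP.
have AX' : A \subset v |: X by apply: subset_trans AX (subsetUr _ _).
have BX' : B \subset v |: X by apply: subset_trans BX (subsetUr _ _).
have vAX : v |: A \subset v |: X by exact: setUS.
have vBX : v |: B \subset v |: X by exact: setUS.
have q0 D : 0 <= q D by exact: ltW.
apply: two_point_four_functions; rewrite ?mulr_ge0//; first exact: qs.
- have := qs _ _ AX' vBX; rewrite setUCA setI_U1r// => h.
  by rewrite mulrCA -mulrA ler_wpM2l.
- have := qs _ _ vAX BX'; rewrite -setUA setI_U1l// => h.
  by rewrite -!mulrA ler_wpM2l.
- have := qs _ _ vAX vBX; rewrite -setUUr -setUIr => h.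
  by rewrite mulrACA [X in _ <= X]mulrACA ler_wpM2l// mulr_ge0.
Qed.

(* By induction on X, cutting one spin at a time with one_edge. *)
Lemma decouple (s : R) (q phi : {set T} -> R) X : 0 < s < 1 ->
  (forall A, 0 < q A) -> (forall A, 0 < phi A) ->
  (forall A B, A \subset X -> B \subset X ->
    q A * q B <= q (A :|: B) * q (A :&: B)) ->
  (forall A B, A \subset X -> B \subset X ->
    phi A * phi B <= phi (A :|: B) * phi (A :&: B)) ->
  exists eta theta : T -> R,
    (\sum_(A : {set T} | A \subset X) q A * expR (\sum_(v in A) eta v)) *
    (\sum_(A : {set T} | A \subset X) phi A * expR (\sum_(v in A) theta v)) <=
    (\sum_(A : {set T} | A \subset X) q A * phi A) *
      expR (s * (\sum_(v in X) (eta v + theta v)) + #|X|%:R * entropy2 s).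
Proof.
move=> s01; have [n] := ubnP #|X|; elim: n X q phi => // n IH X q phi.
rewrite ltnS => Xn qp pp qs ps.
have [->|[v vX]] := set_0Vmem X.
  exists (fun=> 0), (fun=> 0).
  have E (g : {set T} -> R) : \sum_(A : {set T} | A \subset set0) g A = g set0.
    by under eq_bigl do rewrite subset0; rewrite big_pred1_eq.
  by rewrite !E !big_set0 cards0 mulr0 mul0r addr0 !expR0 !mulr1.
set Y := X :\ v.
have vY : v \notin Y by rewrite !inE eqxx.
have EX : X = v |: Y by rewrite setD1K.
have Yn : (#|Y| < n)%N.
  by apply: leq_trans Xn; rewrite [X in (_ < X)%N](cardsD1 v) vX.
have YX : Y \subset X by exact: subsetDl.
rewrite EX in qs ps.
(* The entries of the 2x2 matrix for [one_edge]: the copies of [v] in [q] and in [phi] are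
   independent, all other spins still being shared. *)
pose M (a b : {set T} -> {set T}) := \sum_(A : {set T} | A \subset Y) q (a A) * phi (b A).
have Mp a b : 0 < M a b.
  rewrite /M (bigD1 set0) ?sub0set//= ltr_pwDl ?mulr_gt0//.
  by apply: sumr_ge0 => A _; rewrite mulr_ge0 ?ltW.
pose vU (A : {set T}) := v |: A.
have MM : M id vU * M vU id <= M id id * M vU vU.
  rewrite [X in _ <= X]mulrC.
  apply: (four_functions (a := fun A => q A * phi (vU A)) (b := fun A => q (vU A) * phi A)
    (c := fun A => q (vU A) * phi (vU A)) (e := fun A => q A * phi A))
    => [A|A|A|A|A B AY BY] /=; try by rewrite mulr_ge0 // ltW.
  have vA : v \notin A by apply: contra vY; apply/subsetP.
  have vB : v \notin B by apply: contra vY; apply/subsetP.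
  have AX : A \subset v |: Y by apply: subset_trans AY (subsetUr _ _).
  have BX : B \subset v |: Y by apply: subset_trans BY (subsetUr _ _).
  have vAX : v |: A \subset v |: Y by exact: setUS.
  have vBX : v |: B \subset v |: Y by exact: setUS.
  have h1 := qs _ _ AX vBX; rewrite setUCA setI_U1r// in h1.
  have h2 := ps _ _ vAX BX; rewrite -setUA setI_U1l// in h2.
  rewrite /vU mulrACA [X in _ <= X]mulrACA.
  by apply: ler_pM => //; apply/ltW/mulr_gt0.
have [e1 [t1 h1]] := one_edge s01 (Mp id id) (Mp vU id) (Mp id vU) (Mp vU vU) MM.
(* The copies of [v], now separate, are summed out in their fields [e1] and [t1]. *)
pose q' A := q A + expR e1 * q (v |: A).
pose phi' A := phi A + expR t1 * phi (v |: A).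
have [e2 [t2 h2]] := IH Y q' phi' Yn
  (fun A => addr_gt0 (qp A) (mulr_gt0 (expR_gt0 _) (qp _)))
  (fun A => addr_gt0 (pp A) (mulr_gt0 (expR_gt0 _) (pp _)))
  (log_supermodular_sum1 (expR_ge0 e1) vY qp qs)
  (log_supermodular_sum1 (expR_ge0 t1) vY pp ps).
pose ext (e : R) (f : T -> R) u := if u == v then e else f u.
have extE e f A : v \notin A -> \sum_(u in A) ext e f u = \sum_(u in A) f u.
  move=> vA; apply: eq_bigr => u uA; rewrite /ext.
  by case: eqP => // uv; rewrite -uv uA in vA.
have extU e f A : v \notin A -> \sum_(u in v |: A) ext e f u = e + \sum_(u in A) f u.
  by move=> vA; rewrite big_setU1//= extE// /ext eqxx.
have split_sum (g : {set T} -> R) e f :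
    \sum_(A : {set T} | A \subset X) g A * expR (\sum_(u in A) ext e f u) =
    \sum_(A : {set T} | A \subset Y) (g A + expR e * g (v |: A)) * expR (\sum_(u in A) f u).
  rewrite EX sum_subsetU1//; apply: eq_bigr => A AY.
  have vA : v \notin A by apply: contra vY; apply/subsetP.
  by rewrite extE// extU// expRD; ring.
exists (ext e1 e2), (ext t1 t2); rewrite !split_sum.
apply: le_trans h2 _.
have -> : \sum_(u in X) (ext e1 e2 u + ext t1 t2 u) =
    e1 + t1 + \sum_(u in Y) (e2 u + t2 u).
  rewrite EX big_setU1//= /ext eqxx; congr +%R.
  apply: eq_bigr => u uY; case: eqP => // uv; by rewrite -uv uY in vY.
have -> : #|X|%:R = 1 + #|Y|%:R :> R by rewrite EX cardsU1 vY natrD.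
have -> : \sum_(A : {set T} | A \subset X) q A * phi A = M id id + M vU vU.
  by rewrite EX sum_subsetU1// /M big_split.
have -> : s * (e1 + t1 + \sum_(u in Y) (e2 u + t2 u)) + (1 + #|Y|%:R) * entropy2 s =
    (s * (e1 + t1) + entropy2 s) +
    (s * \sum_(u in Y) (e2 u + t2 u) + #|Y|%:R * entropy2 s) by ring.
rewrite [X in _ <= _ * X]expRD mulrA ler_wpM2r ?expR_ge0//.
apply: le_trans h1; rewrite le_eqVlt; apply/orP; left; apply/eqP.
rewrite /q' /phi' expRD /M !mulr_suml -!big_split /=.
by apply: eq_bigr => A _; rewrite /vU; ring.
Qed.

End LogSupermodular.

(** * Lower bound on the partition function *)

Section LowerBound.
Context {R : realType} {T : finType}.
Implicit Types (A B X : {set T}) (v : T) (w : nat -> R).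

Lemma sum_card_subset X (g : nat -> R) :
  \sum_(A : {set T} | A \subset X) g #|A| =
  \sum_(i < #|X|.+1) 'C(#|X|, i)%:R * g i.
Proof.
rewrite (partition_big (fun A : {set T} => inord #|A| : 'I_#|X|.+1) predT)//=.
apply: eq_bigr => i _.
have -> : 'C(#|X|, i) = #|[set A : {set T} | A \subset X & #|A| == i]|.
  by rewrite cards_draws.
rewrite mulr_natl -sumr_const.
apply: eq_big => A.
  rewrite inE; case AX: (A \subset X) => //=; rewrite -val_eqE /= inordK//.
  by rewrite ltnS subset_leq_card.
move=> /andP[AX /eqP <-]; rewrite inordK//.
by rewrite ltnS subset_leq_card.
Qed.

Lemma sum_card_subset_mem X v (g : nat -> R) : v \in X ->
  \sum_(A : {set T} | A \subset X) (if v \in A then g #|A| else 0) =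
  \sum_(i < #|X|) 'C(#|X|.-1, i)%:R * g i.+1.
Proof.
move=> vX; have vY : v \notin X :\ v by rewrite !inE eqxx.
have cX : #|X| = #|X :\ v|.+1 by rewrite (cardsD1 v) vX.
rewrite -[in LHS](setD1K vX) sum_subsetU1// cX /=.
rewrite -(sum_card_subset _ (fun i => g i.+1)); apply: eq_bigr => A AY.
have vA : v \notin A by apply: contra vY; apply/subsetP.
by rewrite (negbTE vA) setU11 add0r cardsU1 vA add1n.
Qed.

Definition factor_pf k w (t : R) : R :=
  \sum_(i < k.+1) 'C(k, i)%:R * (w i * expR (i%:R * t)).

Lemma factor_pfE w X t :
  factor_pf #|X| w t = \sum_(A : {set T} | A \subset X) w #|A| * expR (#|A|%:R * t).
Proof. by rewrite (sum_card_subset X (fun i => w i * expR (i%:R * t))). Qed.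

(** Jensen's inequality through the tangent [1 + y <= exp y] at the mean field. The linear term
    vanishes: by symmetry every vertex of [X] has the same coefficient [c], and the deviations from
    the mean sum to zero. *)
Lemma factor_pf_mean k w X (th : T -> R) : (0 < k)%N -> #|X| = k ->
  (forall i, (i <= k)%N -> 0 < w i) ->
  factor_pf k w ((\sum_(v in X) th v) / k%:R) <=
  \sum_(A : {set T} | A \subset X) w #|A| * expR (\sum_(v in A) th v).
Proof.
move=> k0 Xk wp; set m := (_ / _).
have kR : k%:R != 0 :> R by rewrite pnatr_eq0 -lt0n.
pose g i := w i * expR (i%:R * m).
pose c : R := \sum_(i < k) 'C(k.-1, i)%:R * g i.+1.
have tangent : \sum_(A : {set T} | A \subset X) g #|A| * (1 + \sum_(v in A) (th v - m)) <=
    \sum_(A : {set T} | A \subset X) w #|A| * expR (\sum_(v in A) th v).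
  apply: ler_sum => A AX; rewrite /g -mulrA ler_wpM2l//.
    by apply/ltW/wp; rewrite -Xk subset_leq_card.
  have -> : \sum_(v in A) th v = #|A|%:R * m + \sum_(v in A) (th v - m).
    by rewrite big_split /= sumrN sumr_const -mulr_natl; ring.
  by rewrite expRD ler_wpM2l ?expR_ge0// expR_ge1Dx.
apply: le_trans tangent; rewrite -Xk factor_pfE le_eqVlt; apply/orP; left; apply/eqP.
under [RHS]eq_bigr do rewrite mulrDr mulr1.
rewrite [RHS]big_split /= -[LHS]addr0; congr +%R.
have -> : \sum_(A : {set T} | A \subset X) g #|A| * \sum_(v in A) (th v - m) =
    \sum_(A : {set T} | A \subset X) \sum_(v in X) (th v - m) * (if v \in A then g #|A| else 0).
  apply: eq_bigr => A AX; rewrite mulr_sumr.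
  rewrite [RHS](bigID (fun v => v \in A)) /= [X in _ + X]big1 ?addr0; last first.
    by move=> v /andP[_ /negbTE ->]; rewrite mulr0.
  apply: eq_big => v; last by move=> vA; rewrite vA mulrC.
  by case vA: (v \in A); rewrite ?andbF// (subsetP AX _ vA).
rewrite exchange_big /= (eq_bigr (fun v => (th v - m) * c)); last first.
  by move=> v vX; rewrite -mulr_sumr sum_card_subset_mem// Xk.
rewrite -mulr_suml big_split /= sumrN sumr_const Xk -mulr_natl /m.
by rewrite mulrCA mulfV// mulr1 subrr mul0r.
Qed.

(** One factor is traded for fields on the other weights. [decouple] separates the marginal of [Q]
    on [X] from the factor. The factor in its fields [theta] is bounded below by [hg] at their mean,
    so that [theta] cancels and only [eta] survives. *)
Lemma factor_to_field k w (s g : R) X (Q : {set T} -> R) : 0 < s < 1 ->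
  (0 < k)%N -> #|X| = k -> log_convex_upto k w ->
  (forall t, g + k%:R * t * s <= ln (factor_pf k w t)) ->
  (forall A, 0 < Q A) -> log_supermodular Q ->
  exists eta : T -> R,
    (\sum_(A : {set T}) Q A * expR (\sum_(v in A) eta v)) *
      expR (g - s * \sum_v eta v - k%:R * entropy2 s) <=
    \sum_(A : {set T}) Q A * w #|A :&: X|.
Proof.
move=> s01 k0 Xk wlc hg Qp Qs; have [wp _] := wlc.
pose q B := \sum_(A : {set T} | A :&: X == B :&: X) Q A.
pose phi B := w #|B :&: X|.
have qp B : 0 < q B.
  rewrite /q (bigD1 B)//= ltr_pwDl//; apply: sumr_ge0 => A _; exact: ltW.
have phip B : 0 < phi B by apply: wp; rewrite -Xk subset_leq_card ?subsetIr.
have qs (B C : {set T}) : B \subset X -> C \subset X -> q B * q C <= q (B :|: C) * q (B :&: C).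
  move=> BX CX; rewrite /q.
  have E (D : {set T}) : \sum_(A : {set T} | A :&: X == D :&: X) Q A =
    \sum_(A : {set T} | A \subset setT) (if A :&: X == D :&: X then Q A else 0).
    by rewrite big_mkcond; apply: eq_bigl => A; rewrite subsetT.
  rewrite !E; apply: four_functions => [A|A|A|A|A A' _ _];
    try by case: ifP => // _; exact: ltW.
  case: eqP => [h1|_]; last by rewrite mul0r mulr_ge0//; case: ifP => // _; exact: ltW.
  case: eqP => [h2|_]; last by rewrite mulr0 mulr_ge0//; case: ifP => // _; exact: ltW.
  by rewrite !setIUl h1 h2 eqxx !(setIIl _ _ X) h1 h2 eqxx Qs.
have group f : \sum_(A : {set T}) Q A * f (A :&: X) = \sum_(B : {set T} | B \subset X) q B * f B.
  rewrite (partition_big (fun A => A :&: X) (fun B : {set T} => B \subset X)) /=; last first.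
    by move=> A _; exact: subsetIr.
  apply: eq_bigr => B BX; rewrite /q mulr_suml (setIidPl BX).
  by apply: eq_bigr => A /eqP ->.
have [eta [theta h]] := decouple s01 qp phip qs
  (fun A B _ _ => log_supermodular_card wlc (eq_leq Xk) A B).
pose eta' v := if v \in X then eta v else 0.
have etaE A : \sum_(v in A) eta' v = \sum_(v in A :&: X) eta v.
  rewrite /eta' -big_mkcondr; apply: eq_bigl => v; by rewrite inE.
exists eta'; under eq_bigr do rewrite etaE.
rewrite (group (fun B => expR (\sum_(v in B) eta v))) (group (fun B => w #|B|)).
have -> : \sum_v eta' v = \sum_(v in X) eta v.
  by rewrite /eta' -big_mkcond.
have phiE : \sum_(A : {set T} | A \subset X) phi A * expR (\sum_(v in A) theta v) =
   \sum_(A : {set T} | A \subset X) w #|A| * expR (\sum_(v in A) theta v).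
  by apply: eq_bigr => A AX; rewrite /phi (setIidPl AX).
have q0 : 0 <= \sum_(B : {set T} | B \subset X) q B * expR (\sum_(v in B) eta v).
  by apply: sumr_ge0 => B _; rewrite mulr_ge0 ?expR_ge0// ltW.
have phi_lb : expR (g + s * \sum_(v in X) theta v) <=
    \sum_(A : {set T} | A \subset X) phi A * expR (\sum_(v in A) theta v).
  rewrite phiE; apply: le_trans (factor_pf_mean theta k0 Xk wp).
  have fp t : 0 < factor_pf k w t.
    rewrite /factor_pf big_ord_recl /= bin0 mul1r ltr_pwDl ?mulr_gt0 ?expR_gt0 ?wp//.
    by apply: sumr_ge0 => i _; rewrite !mulr_ge0 ?expR_ge0// ltW// wp//=.
  rewrite -(expR_ln (fp _)) ler_expR; apply: le_trans (hg _).
  rewrite mulrCA mulfV ?pnatr_eq0 -?lt0n// mulr1; lra.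
have {}h := le_trans (ler_wpM2l q0 phi_lb) h.
have -> : \sum_(B : {set T} | B \subset X) q B * w #|B| =
    \sum_(A : {set T} | A \subset X) q A * phi A.
  by apply: eq_bigr => A AX; rewrite /phi (setIidPl AX).
rewrite -(ler_pM2r (expR_gt0 (s * \sum_(v in X) (eta v + theta v) + #|X|%:R * entropy2 s))).
apply: le_trans h; rewrite -mulrA -expRD le_eqVlt; apply/orP; left; apply/eqP.
by congr (_ * expR _); rewrite big_split /= Xk; ring.
Qed.

(** With no factor left the sum is a product over vertices, and [gibbs_two_point] with weights 1 and
    [expR (lam v)] bounds each term. *)
Lemma sum_fields_lb (s : R) (lam : T -> R) : 0 < s < 1 ->
  expR (s * \sum_v lam v + #|T|%:R * entropy2 s) <=
  \sum_(A : {set T}) expR (\sum_(v in A) lam v).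
Proof.
move=> s01.
have -> : \sum_(A : {set T}) expR (\sum_(v in A) lam v) = \prod_v (expR (lam v) + 1).
  rewrite bigA_distr /=; apply: eq_big => // A _.
  by rewrite expR_sum big_mkcond.
rewrite mulr_sumr -sum1_card natr_sum mulr_suml -big_split /= expR_sum.
apply: ler_prod => v _; rewrite expR_ge0 /= mul1r.
have p1 : 0 < expR (lam v) by exact: expR_gt0.
have := gibbs_two_point s01 (@ltr01 R) p1; rewrite ln1 expRK mulr0 add0r => h.
have p2 : 0 < expR (lam v) + 1 by lra.
by rewrite -(expR_ln p2) ler_expR [expR _ + 1]addrC.
Qed.

Lemma partition_lower_bound (I : finType) (N : I -> {set T}) k w (s g : R) :
  0 < s < 1 -> (0 < k)%N -> (forall i, #|N i| = k) -> log_convex_upto k w ->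
  (forall t, g + k%:R * t * s <= ln (factor_pf k w t)) ->
  expR (#|I|%:R * (g - k%:R * entropy2 s) + #|T|%:R * entropy2 s) <=
  \sum_(A : {set T}) \prod_i w #|A :&: N i|.
Proof.
move=> s01 k0 Nk wlc hg; have [wp _] := wlc.
have wNp i A : 0 < w #|A :&: N i| by apply: wp; rewrite -(Nk i) subset_leq_card ?subsetIr.
(* The induction over the factors still present carries arbitrary fields [lam], which accumulate
   those left by the factors already removed. *)
suff H (r : seq I) (lam : T -> R) :
    expR ((size r)%:R * (g - k%:R * entropy2 s) +
          (s * \sum_v lam v + #|T|%:R * entropy2 s)) <=
    \sum_(A : {set T}) (\prod_(i <- r) w #|A :&: N i|) * expR (\sum_(v in A) lam v).
  have := H (enum I) (fun=> 0).
  rewrite big1// mulr0 add0r -cardT => h; apply: le_trans h _.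
  rewrite le_eqVlt; apply/orP; left; apply/eqP; apply: eq_bigr => A _.
  by rewrite big1_eq expR0 mulr1 big_enum.
elim: r lam => [|i r IH] lam.
  rewrite mul0r add0r; apply: le_trans (sum_fields_lb lam s01) _.
  by under [X in _ <= X]eq_bigr do rewrite big_nil mul1r.
pose Q A := (\prod_(i <- r) w #|A :&: N i|) * expR (\sum_(v in A) lam v).
have Qp A : 0 < Q A by rewrite mulr_gt0 ?expR_gt0// prodr_gt0.
have Qs : log_supermodular Q.
  apply: log_supermodularM => [A|A||]; [|exact: expR_ge0| |exact: log_supermodular_field].
    by apply: prodr_ge0 => j _; exact: ltW.
  apply: log_supermodular_prod => [j A|j]; first exact: ltW.
  by apply: log_supermodular_card wlc _; rewrite Nk.
have [eta h] := factor_to_field s01 k0 (Nk i) wlc hg Qp Qs.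
have -> : \sum_(A : {set T}) (\prod_(j <- i :: r) w #|A :&: N j|) * expR (\sum_(v in A) lam v) =
    \sum_(A : {set T}) Q A * w #|A :&: N i|.
  by apply: eq_bigr => A _; rewrite big_cons /Q; ring.
apply: le_trans h.
have := IH (fun v => lam v + eta v).
have -> : \sum_(A : {set T}) (\prod_(j <- r) w #|A :&: N j|) * expR (\sum_(v in A) (lam v + eta v)) =
    \sum_(A : {set T}) Q A * expR (\sum_(v in A) eta v).
  by apply: eq_bigr => A _; rewrite big_split /= expRD mulrA.
move=> h; apply: le_trans (ler_wpM2r (expR_ge0 _) h).
rewrite -expRD ler_expR big_split /= -[(size r).+1]addn1 natrD; lra.
Qed.

End LowerBound.

(** * Conditional expectations and FKG *)

Section ConditionalExpectation.
Context {R : realType} {T : finType}.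
Context (P : {set T} -> R).
Implicit Types (A B C S X : {set T}) (u v : T) (f g : {set T} -> R).

(** A configuration is the set of its spins equal to 1, and [A :&: S] is what is known once the
    spins in [S] are revealed. Marginals and conditional expectations are kept as functions of the
    whole configuration. *)
Definition marg S A := \sum_(B : {set T} | B :&: S == A :&: S) P B.

Definition cexp S f A :=
  (\sum_(B : {set T} | B :&: S == A :&: S) P B * f B) / marg S A.

Definition expect f := \sum_(A : {set T}) P A * f A.

Definition measurable_wrt S f := forall A B, A :&: S = B :&: S -> f A = f B.

Definition ind v A : R := (v \in A)%:R.

Definition cov S f g A :=
  cexp S (fun B => f B * g B) A - cexp S f A * cexp S g A.

Definition increasing f := forall A B, A \subset B -> f A <= f B.

Context (P_gt0 : forall A, 0 < P A).

Lemma marg_gt0 S A : 0 < marg S A.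
Proof.
by rewrite /marg (bigD1 A)//= ltr_pwDl//; apply: sumr_ge0 => B _; exact: ltW.
Qed.

Lemma marg_neq0 S A : marg S A != 0.
Proof. by rewrite gt_eqF// marg_gt0. Qed.

Lemma marg_meas S : measurable_wrt S (marg S).
Proof. by move=> A B AB; rewrite /marg AB. Qed.

Lemma cexp_meas S f : measurable_wrt S (cexp S f).
Proof. by move=> A B AB; rewrite /cexp /marg AB. Qed.

Lemma ind_meas S v : v \in S -> measurable_wrt S (ind v).
Proof.
by move=> vS A B /setP/(_ v); rewrite !inE vS !andbT /ind => ->.
Qed.

Lemma ind_ge0 v A : 0 <= ind v A. Proof. exact: ler0n. Qed.

Lemma ind_idem v A : ind v A * ind v A = ind v A.
Proof. by rewrite /ind -natrM mulnb andbb. Qed.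

Lemma ind_incr v : increasing (ind v).
Proof.
by move=> A B AB; rewrite /ind ler_nat; case vA: (v \in A) => //; rewrite (subsetP AB _ vA).
Qed.

Lemma cexp_eq S f g A : (forall B, B :&: S = A :&: S -> f B = g B) ->
  cexp S f A = cexp S g A.
Proof.
by move=> fg; rewrite /cexp; congr (_ / _); apply: eq_bigr => B /eqP BA; rewrite fg.
Qed.

Lemma cexp_ext S f g A : f =1 g -> cexp S f A = cexp S g A.
Proof. by move=> fg; apply: cexp_eq => B _. Qed.

Lemma cexpD S f g A : cexp S (fun B => f B + g B) A = cexp S f A + cexp S g A.
Proof.
rewrite /cexp -mulrDl -big_split /=; congr (_ / _).
by apply: eq_bigr => B _; rewrite mulrDr.
Qed.

Lemma cexpM S f g A : measurable_wrt S f ->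
  cexp S (fun B => f B * g B) A = f A * cexp S g A.
Proof.
move=> fS; rewrite /cexp mulrA mulr_sumr; congr (_ / _).
by apply: eq_bigr => B /eqP BA; rewrite mulrCA (fS _ _ BA).
Qed.

Lemma cexpZ S c f A : cexp S (fun B => c * f B) A = c * cexp S f A.
Proof. by rewrite (cexpM (f := fun=> c)). Qed.

Lemma cexp_cst S c A : cexp S (fun=> c) A = c.
Proof. by rewrite /cexp -mulr_suml mulrAC divff ?mul1r// marg_neq0. Qed.

Lemma cexp_id S f A : measurable_wrt S f -> cexp S f A = f A.
Proof.
move=> fS; rewrite -[RHS]mulr1 -(cexp_cst S 1 A) -cexpM//.
by apply: cexp_ext => B; rewrite mulr1.
Qed.

Lemma cexpB S f g A : cexp S (fun B => f B - g B) A = cexp S f A - cexp S g A.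
Proof.
rewrite cexpD -[- cexp S g A]mulN1r -cexpZ; congr +%R.
by apply: cexp_ext => B; rewrite mulN1r.
Qed.

Lemma cexp_sum S (I : Type) (r : seq I) (p : pred I) (F : I -> {set T} -> R) A :
  cexp S (fun B => \sum_(i <- r | p i) F i B) A = \sum_(i <- r | p i) cexp S (F i) A.
Proof.
elim: r => [|i r IH].
  by rewrite big_nil -[RHS](cexp_cst S 0 A); apply: cexp_ext => B; rewrite big_nil.
rewrite big_cons -IH; case: ifP => pi; last first.
  by apply: cexp_ext => B; rewrite big_cons pi.
by rewrite -cexpD; apply: cexp_ext => B; rewrite big_cons pi.
Qed.

Lemma cexp_le S f g A : (forall B, f B <= g B) -> cexp S f A <= cexp S g A.
Proof.
move=> fg; rewrite ler_pM2r ?invr_gt0 ?marg_gt0//.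
by apply: ler_sum => B _; rewrite ler_wpM2l ?fg// ltW.
Qed.

Lemma cexp_ge0 S f A : (forall B, 0 <= f B) -> 0 <= cexp S f A.
Proof. by move=> f0; rewrite -(cexp_cst S 0 A); exact: cexp_le. Qed.

Lemma cexp_tower S X f A : S \subset X -> cexp S (cexp X f) A = cexp S f A.
Proof.
move=> SX; rewrite /cexp; congr (_ / _).
under eq_bigr do rewrite mulr_suml mulr_sumr.
rewrite (exchange_big_dep (fun C : {set T} => C :&: S == A :&: S)) /=; last first.
  move=> B C /eqP BA /eqP CB; apply/eqP; rewrite -BA -(setIidPr SX) !setIA.
  by rewrite CB.
apply: eq_bigr => C /eqP CA.
rewrite -[RHS]mulr1 -(divff (marg_neq0 X C)) {2}/marg !mulr_suml mulr_sumr.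
apply: eq_big => [B|B /andP[_ /eqP CB]].
  rewrite [C :&: X == _]eq_sym andb_idl// => /eqP BC.
  by rewrite -CA -(setIidPr SX) !setIA BC.
by rewrite /marg CB; ring.
Qed.

Lemma cexp_towerM S X f g A : S \subset X -> measurable_wrt X g ->
  cexp S (fun B => g B * cexp X f B) A = cexp S (fun B => g B * f B) A.
Proof.
move=> SX gX; rewrite -[RHS](cexp_tower _ _ SX); apply: cexp_ext => B.
by rewrite cexpM.
Qed.

Context (P_sum1 : \sum_A P A = 1).

Lemma marg0 A : marg set0 A = 1.
Proof. by rewrite /marg -P_sum1; apply: eq_bigl => B; rewrite !setI0 eqxx. Qed.

Lemma expectE f A : expect f = cexp set0 f A.
Proof.
by rewrite /cexp marg0 divr1; apply: eq_bigl => B; rewrite !setI0 eqxx.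
Qed.

Lemma expect_cexp S f : expect (cexp S f) = expect f.
Proof. by rewrite !(expectE _ set0) cexp_tower// sub0set. Qed.

Lemma expect_cexpM S f g : measurable_wrt S g ->
  expect (fun B => g B * cexp S f B) = expect (fun B => g B * f B).
Proof. by move=> gS; rewrite !(expectE _ set0) cexp_towerM// sub0set. Qed.

Lemma expect_ext f g : f =1 g -> expect f = expect g.
Proof. by move=> fg; apply: eq_bigr => A _; rewrite fg. Qed.

Lemma expect_le f g : (forall A, f A <= g A) -> expect f <= expect g.
Proof. by move=> fg; apply: ler_sum => A _; rewrite ler_wpM2l ?fg// ltW. Qed.

Lemma expectD f g : expect (fun A => f A + g A) = expect f + expect g.
Proof. by rewrite !(expectE _ set0) cexpD. Qed.

Lemma expectB f g : expect (fun A => f A - g A) = expect f - expect g.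
Proof. by rewrite !(expectE _ set0) cexpB. Qed.

Lemma expectZ c f : expect (fun A => c * f A) = c * expect f.
Proof. by rewrite !(expectE _ set0) cexpZ. Qed.

Lemma expect_cst c : expect (fun=> c) = c.
Proof. by rewrite !(expectE _ set0) cexp_cst. Qed.

Lemma expect_sum (I : Type) (r : seq I) (p : pred I) (F : I -> {set T} -> R) :
  expect (fun B => \sum_(i <- r | p i) F i B) = \sum_(i <- r | p i) expect (F i).
Proof. by rewrite (expectE _ set0) cexp_sum; apply: eq_bigr => i _; rewrite (expectE _ set0). Qed.

Lemma cov_sym S f g A : cov S f g A = cov S g f A.
Proof.
rewrite /cov [cexp S f A * _]mulrC; congr (_ - _).
by apply: cexp_ext => B; rewrite mulrC.
Qed.

Lemma cov_addZr S f g1 g2 c A :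
  cov S f (fun B => g1 B + c * g2 B) A = cov S f g1 A + c * cov S f g2 A.
Proof.
rewrite /cov cexpD cexpZ.
have -> : cexp S (fun B => f B * (g1 B + c * g2 B)) A =
    cexp S (fun B => f B * g1 B) A + c * cexp S (fun B => f B * g2 B) A.
  by rewrite -cexpZ -cexpD; apply: cexp_ext => B; ring.
ring.
Qed.

Lemma cov_meas S f g A : measurable_wrt S g -> cov S f g A = 0.
Proof.
move=> gS; rewrite cov_sym /cov (cexpM _ _ gS) (cexp_id _ gS); exact: subrr.
Qed.

Lemma cov_sumr S f (I : Type) (r : seq I) (p : pred I) (F : I -> {set T} -> R) A :
  cov S f (fun B => \sum_(i <- r | p i) F i B) A = \sum_(i <- r | p i) cov S f (F i) A.
Proof.
rewrite /cov sumrB -mulr_sumr -!cexp_sum; congr (_ - _).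
by apply: cexp_ext => B; rewrite mulr_sumr.
Qed.

Lemma cexp_sqr_sub S f c A :
  cexp S (fun B => (f B - c) ^+ 2) A = cov S f f A + (cexp S f A - c) ^+ 2.
Proof.
have -> : cexp S (fun B => (f B - c) ^+ 2) A =
    cexp S (fun B => f B * f B) A - 2 * c * cexp S f A + c ^+ 2.
  rewrite -[X in _ + X](cexp_cst S _ A) -cexpZ -cexpB -cexpD.
  by apply: cexp_ext => B; ring.
rewrite /cov; ring.
Qed.

Lemma var_le_sqr S f c A : cov S f f A <= cexp S (fun B => (f B - c) ^+ 2) A.
Proof. by rewrite cexp_sqr_sub lerDl sqr_ge0. Qed.

Lemma var_ge0 S f A : 0 <= cov S f f A.
Proof.
have := cexp_sqr_sub S f (cexp S f A) A.
rewrite subrr expr0n addr0 => <-; apply: cexp_ge0 => B; exact: sqr_ge0.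
Qed.

Lemma cov_tower S X f g A : S \subset X -> measurable_wrt X g ->
  cov S f g A = cov S (cexp X f) g A.
Proof.
move=> SX gX; rewrite /cov (cexp_tower _ _ SX); congr (_ - _).
transitivity (cexp S (fun B => g B * f B) A); first by apply: cexp_ext => B; rewrite mulrC.
by rewrite -(cexp_towerM _ _ SX gX); apply: cexp_ext => B; rewrite mulrC.
Qed.

Lemma cexp_ind_ge0 S v A : 0 <= cexp S (ind v) A.
Proof. by apply: cexp_ge0 => B; exact: ind_ge0. Qed.

Lemma cexp_ind_le1 S v A : cexp S (ind v) A <= 1.
Proof.
rewrite -[leRHS](cexp_cst S 1 A); apply: cexp_le => B.
by rewrite /ind lern1 leq_b1.
Qed.

Lemma var_ind S v A :
  cov S (ind v) (ind v) A = cexp S (ind v) A * (1 - cexp S (ind v) A).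
Proof. by rewrite /cov (cexp_ext _ _ (ind_idem v)); ring. Qed.

Lemma var_ind_le1 S v A : cov S (ind v) (ind v) A <= 1.
Proof.
rewrite var_ind; have := cexp_ind_ge0 S v A; have := cexp_ind_le1 S v A; nra.
Qed.

(** With [c] the covariance, the left side expands to the variance of [f] minus [2 * c ^+ 2] plus
    [c ^+ 2] times the variance of a spin, which is at most 1. Using [c] in place of the regression
    coefficient avoids a division. *)
Lemma var_sub_proj S f u A :
  cov S (fun B => f B - cov S f (ind u) A * ind u B)
        (fun B => f B - cov S f (ind u) A * ind u B) A <=
  cov S f f A - cov S f (ind u) A ^+ 2.
Proof.
set c := cov S f (ind u) A; pose h B := f B + (- c) * ind u B.
have -> : cov S (fun B => f B - c * ind u B) (fun B => f B - c * ind u B) A =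
    cov S h h A.
  by congr (cov S _ _ A); apply/funext => B; rewrite /h mulNr.
rewrite [X in X <= _]cov_addZr ![cov S h _ A]cov_sym !cov_addZr.
rewrite -/c [cov S (ind u) f A]cov_sym -/c.
have := var_ind_le1 S u A; have : 0 <= c ^+ 2 by exact: sqr_ge0.
by nra.
Qed.

Lemma cov_sqr_le_var S f u A : cov S f (ind u) A ^+ 2 <= cov S f f A.
Proof.
have := var_sub_proj S f u A.
have := var_ge0 S (fun B => f B - cov S f (ind u) A * ind u B) A; lra.
Qed.

(* Compare with the projection of f on the affine functions of x_u given S. *)
Lemma expect_var_step S f u :
  expect (cov (u |: S) f f) <=
  expect (cov S f f) - expect (fun A => cov S f (ind u) A ^+ 2).
Proof.
pose g A := cexp S f A + cov S f (ind u) A * (ind u A - cexp S (ind u) A).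
have SuS : S \subset u |: S by exact: subsetUr.
have gm : measurable_wrt (u |: S) g.
  move=> A B AB; have AB' : A :&: S = B :&: S.
    by rewrite -(setIidPr SuS) !setIA AB.
  rewrite /g /cov (cexp_meas _ AB') (cexp_meas _ AB') (cexp_meas (ind u) AB').
  by rewrite (ind_meas (setU11 u S) AB).
have h1 : expect (cov (u |: S) f f) <= expect (fun A => (f A - g A) ^+ 2).
  rewrite -(expect_cexp (u |: S) (fun A => (f A - g A) ^+ 2)).
  apply: expect_le => A; apply: le_trans (var_le_sqr _ _ (g A) _) _.
  rewrite le_eqVlt; apply/orP; left; apply/eqP; apply: cexp_eq => B BA.
  by rewrite (gm _ _ BA).
apply: le_trans h1 _; rewrite -expectB -(expect_cexp S (fun A => (f A - g A) ^+ 2)).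
apply: expect_le => A; apply: le_trans (var_sub_proj S f u A).
set h := fun B => f B - _.
have := cexp_sqr_sub S h (cexp S h A) A; rewrite subrr expr0n addr0 => <-.
rewrite le_eqVlt; apply/orP; left; apply/eqP; apply: cexp_eq => B BA.
rewrite /h cexpB cexpZ /g /cov !(cexp_meas _ BA); congr (_ ^+ 2); ring.
Qed.

Lemma sum_class_split S u A f : u \notin S ->
  \sum_(B : {set T} | B :&: S == A :&: S) f B =
  \sum_(B : {set T} | (B :&: S == A :&: S) && (u \in B)) f B +
  \sum_(B : {set T} | (B :&: S == A :&: S) && (u \notin B)) f B.
Proof. by move=> uS; rewrite (bigID (fun B : {set T} => u \in B)). Qed.

Lemma class_setU1 S u A B :
  (B :&: (u |: S) == A :&: (u |: S)) = (B :&: S == A :&: S) && ((u \in B) == (u \in A)).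
Proof.
apply/eqP/andP => [BA|[/eqP BA /eqP uBA]].
  split; last by have /setP/(_ u) := BA; rewrite !inE eqxx /= !andbT => ->.
  apply/eqP; have SuS : S \subset u |: S by exact: subsetUr.
  by rewrite -(setIidPr SuS) !setIA BA.
apply/setP => x; have /setP/(_ x) := BA; rewrite !inE.
by case: eqP => [->|//]; rewrite !andbT.
Qed.

Lemma marg_setU1 S u A : u \notin S ->
  marg (u |: S) A =
  marg S A * (if u \in A then cexp S (ind u) A else 1 - cexp S (ind u) A).
Proof.
move=> uS; rewrite {1}/marg; under eq_bigl do rewrite class_setU1.
have indE : \sum_(B : {set T} | B :&: S == A :&: S) P B * ind u B =
    \sum_(B : {set T} | (B :&: S == A :&: S) && (u \in B)) P B.
  rewrite big_mkcondr; apply: eq_bigr => B _; rewrite /ind.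
  by case: ifP => _; rewrite ?mulr1 ?mulr0.
case: ifP => uA.
  rewrite /cexp indE mulrCA divff ?mulr1 ?marg_neq0//.
  by apply: eq_bigl => B; rewrite eqb_id.
rewrite mulrBr mulr1 /cexp indE mulrCA divff ?mulr1 ?marg_neq0//.
rewrite /marg (sum_class_split _ _ uS) addrAC subrr add0r.
by apply: eq_bigl => B; case: (u \in B).
Qed.

Lemma cexp_ind_gt0 S u A : u \notin S -> 0 < cexp S (ind u) A.
Proof.
move=> uS; rewrite /cexp divr_gt0 ?marg_gt0// (bigD1 (u |: A)) /=; last first.
  by rewrite setI_U1l.
rewrite /ind setU11 mulr1 ltr_pwDl//; apply: sumr_ge0 => B _.
by rewrite mulr_ge0// ltW.
Qed.

Lemma cexp_ind_lt1 S u A : u \notin S -> cexp S (ind u) A < 1.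
Proof.
move=> uS; have : 0 < marg (u |: S) (A :\ u) by exact: marg_gt0.
rewrite marg_setU1// !inE eqxx /= pmulr_rgt0 ?marg_gt0// subr_gt0.
rewrite (_ : cexp S (ind u) (A :\ u) = cexp S (ind u) A)//.
apply: cexp_meas; apply/setP => x; rewrite !inE.
by case: eqP => [->|//]; rewrite (negbTE uS) !andbF.
Qed.

(** A function of one spin is affine in its indicator, so revealing [u] is an exact linear
    regression on [ind u]. *)
Lemma cexp_setU1 S u f A : u \notin S ->
  cexp (u |: S) f A = cexp S f A +
    cov S f (ind u) A / cov S (ind u) (ind u) A * (ind u A - cexp S (ind u) A).
Proof.
move=> uS; rewrite var_ind /cov.
have p0 := cexp_ind_gt0 A uS; have p1 := cexp_ind_lt1 A uS.
have mu := marg_neq0 S A.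
set p := cexp S (ind u) A in p0 p1 *.
have -> : cexp S (fun B => f B * ind u B) A =
    (\sum_(B : {set T} | (B :&: S == A :&: S) && (u \in B)) P B * f B) / marg S A.
  rewrite /cexp; congr (_ / _); rewrite big_mkcondr; apply: eq_bigr => B _.
  by rewrite /ind; case: ifP => _; rewrite ?mulr1 ?mulr0.
have -> : cexp S f A =
    (\sum_(B : {set T} | (B :&: S == A :&: S) && (u \in B)) P B * f B +
     \sum_(B : {set T} | (B :&: S == A :&: S) && (u \notin B)) P B * f B) / marg S A.
  by rewrite /cexp (sum_class_split _ _ uS).
rewrite {1}/cexp marg_setU1//; under eq_bigl do rewrite class_setU1.
set F1 := \sum_(B : {set T} | _ && (u \in B)) _.
set F0 := \sum_(B : {set T} | _ && (u \notin B)) _.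
rewrite -/p /ind.
case: (u \in A).
- have -> : \sum_(B : {set T} | (B :&: S == A :&: S) && ((u \in B) == true)) P B * f B = F1.
    by apply: eq_bigl => B; rewrite eqb_id.
  rewrite (_ : true%:R = 1 :> R)//; by field; rewrite mu !gt_eqF// subr_gt0.
- have -> : \sum_(B : {set T} | (B :&: S == A :&: S) && ((u \in B) == false)) P B * f B = F0.
    by apply: eq_bigl => B; rewrite eqbF_neg.
  rewrite (_ : false%:R = 0 :> R)//; by field; rewrite mu !gt_eqF// subr_gt0.
Qed.

(** * The FKG inequality for conditional measures *)

Context (P_lsm : log_supermodular P).

(** The configurations agreeing with [A] on [S] form a sublattice, on which the four functions
    theorem is applied to [P f], [P g], [P f g] and [P], extended by zero. *)
Lemma cexp_fkg S f g A : (forall A, 0 <= f A) -> (forall A, 0 <= g A) ->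
  increasing f -> increasing g ->
  cexp S f A * cexp S g A <= cexp S (fun B => f B * g B) A.
Proof.
move=> f0 g0 fi gi; have M := marg_gt0 S A.
rewrite /cexp mulf_div ler_pdivrMr ?mulr_gt0//.
rewrite [X in _ <= X](_ : _ = (\sum_(B : {set T} | B :&: S == A :&: S) P B * (f B * g B)) *
  marg S A); last by field; exact: marg_neq0.
have E h : \sum_(B : {set T} | B :&: S == A :&: S) h B =
    \sum_(B : {set T} | B \subset setT) (if B :&: S == A :&: S then h B else 0) :> R.
  by rewrite big_mkcond; apply: eq_bigl => B; rewrite subsetT.
have P0 B : 0 <= P B by exact: ltW.
rewrite /marg !E; apply: four_functions => [B|B|B|B|B C _ _];
  try by case: ifP => // _; rewrite ?mulr_ge0.
have rhs0 : 0 <= (if (B :|: C) :&: S == A :&: S then P (B :|: C) * (f (B :|: C) * g (B :|: C)) else 0)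
    * (if B :&: C :&: S == A :&: S then P (B :&: C) else 0).
  by apply: mulr_ge0; case: ifP => // _; rewrite !mulr_ge0.
case: eqP => [BA|_]; last by rewrite mul0r.
case: eqP => [CA|_]; last by rewrite mulr0.
rewrite setIUl [B :&: C :&: S]setIIl BA CA setUid setIid !eqxx.
rewrite mulrACA [X in _ <= X]mulrAC.
by apply: ler_pM; rewrite ?mulr_ge0//; apply: ler_pM => //;
  [apply: fi; exact: subsetUl|apply: gi; exact: subsetUr].
Qed.

Lemma cov_ge0 S f g A : (forall A, 0 <= f A) -> (forall A, 0 <= g A) ->
  increasing f -> increasing g -> 0 <= cov S f g A.
Proof. by move=> *; rewrite subr_ge0; exact: cexp_fkg. Qed.

Lemma cov_ind_ge0 S u v A : 0 <= cov S (ind u) (ind v) A.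
Proof. by apply: cov_ge0; [exact: ind_ge0|exact: ind_ge0|exact: ind_incr|exact: ind_incr]. Qed.

(* FKG for ind v and \sum_(w in S :|: Y) ind w - cexp X (ind v), which is
   increasing because cexp X (ind v) takes values in [0, 1]. *)
Lemma var_cexp_le_sum S X (Y : {set T}) v A : S \subset X ->
  measurable_wrt (S :|: Y) (cexp X (ind v)) ->
  cov S (cexp X (ind v)) (cexp X (ind v)) A <=
  \sum_(w in Y) cov S (ind v) (ind w) A.
Proof.
move=> SX NY; set N := cexp X (ind v).
rewrite -(cov_tower (ind v) _ SX (@cexp_meas X (ind v))) -/N.
pose h B := \sum_(w in S :|: Y) ind w B.
(* The added 1 makes [g] nonnegative, as [cov_ge0] requires. *)
pose g B := 1 + (h B - N B).
have N0 B : 0 <= N B by exact: cexp_ind_ge0.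
have N1 B : N B <= 1 by exact: cexp_ind_le1.
have h0 B : 0 <= h B by apply: sumr_ge0 => w _; exact: ind_ge0.
have g0 B : 0 <= g B by rewrite /g; have := N1 B; have := h0 B; lra.
have gi : increasing g.
  move=> B C BC; rewrite /g lerD2l.
  have [E|NE] := eqVneq (B :&: (S :|: Y)) (C :&: (S :|: Y)).
    have -> : N B = N C by exact: NY.
    rewrite lerD2r; apply: ler_sum => w _; exact: ind_incr.
  suff : h B + 1 <= h C by have := N0 B; have := N1 C; lra.
  have /subsetPn[w wC wB] : ~~ (C :&: (S :|: Y) \subset B :&: (S :|: Y)).
    by apply: contra NE => CB; rewrite eqEsubset CB setSI.
  move: wC wB; rewrite !inE => /andP[wC wSY]; rewrite wSY andbT => wB.
  have wSY' : w \in S :|: Y by rewrite inE.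
  have -> : h C = 1 + \sum_(x in S :|: Y | x != w) ind x C.
    by rewrite /h (bigD1 w)//=; congr +%R; rewrite /ind wC.
  have -> : h B = 0 + \sum_(x in S :|: Y | x != w) ind x B.
    by rewrite /h (bigD1 w)//=; congr +%R; rewrite /ind (negbTE wB).
  rewrite add0r addrC lerD2l; apply: ler_sum => x _; exact: ind_incr.
have := cov_ge0 S A (@ind_ge0 v) g0 (ind_incr v) gi.
have -> : cov S (ind v) g A = cov S (ind v) h A - cov S (ind v) N A.
  have -> : g = (fun B => (h B + (-1) * N B) + 1 * 1).
    by apply/funext => B; rewrite /g; ring.
  by rewrite !cov_addZr (@cov_meas S (ind v) (fun=> 1))//; ring.
rewrite subr_ge0 => H; apply: le_trans H _.
rewrite /h cov_sumr (big_setID S) /= big1 ?add0r; last first.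
  by move=> w; rewrite inE => /andP[_ wS]; rewrite cov_meas//; exact: ind_meas.
rewrite [X in _ <= X](big_setID S) /= setDUl setDv set0U lerDr.
by apply: sumr_ge0 => w _; exact: cov_ind_ge0.
Qed.

End ConditionalExpectation.

(** * Entropy *)

Section Entropy.
Context {R : realType} {T : finType}.
Context (P : {set T} -> R).
Context (P_gt0 : forall A, 0 < P A).
Context (P_sum1 : \sum_A P A = 1).
Implicit Types (A B C S X Y : {set T}) (u v : T) (f g : {set T} -> R).

Definition entropy S := expect P (fun A => - ln (marg P S A)).

Definition centropy v S := entropy (v |: S) - entropy S.

Lemma entropy2_le_ln2 (s : R) : 0 < s < 1 -> entropy2 s <= ln 2.
Proof.
move=> s01; have := gibbs_two_point s01 (@ltr01 R) (@ltr01 R).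
by rewrite ln1 !mulr0 !add0r.
Qed.

(** Nonnegativity of the relative entropy of two Bernoulli laws. *)
Lemma entropy2_cross (b a : R) : 0 <= b <= 1 -> 0 < a < 1 ->
  entropy2 b <= - (b * ln a) - (1 - b) * ln (1 - a).
Proof.
move=> /andP[b0 b1] /andP[a0 a1]; rewrite /entropy2.
have a1' : 0 < 1 - a by lra.
have key (x y : R) : 0 <= x -> 0 < y -> x * ln y <= x * ln x + (y - x).
  move=> x0 y0; have [->|xn0] := eqVneq x 0; first by rewrite !mul0r; lra.
  have xp : 0 < x by rewrite lt_def xn0.
  have := ler_wpM2l x0 (ln_le_sub1 (divr_gt0 y0 xp)).
  rewrite ln_div_pos// !mulrBr mulr1 [x * (y / x)]mulrC divfK//; lra.
have := key b a b0 a0; have := key (1 - b) (1 - a) ltac:(lra) a1'; lra.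
Qed.

(** The relative entropy is at most the chi-square divergence, by [ln x <= x - 1]. *)
Lemma entropy2_gap (b a : R) : 0 < b < 1 -> 0 < a < 1 ->
  - (b * ln a) - (1 - b) * ln (1 - a) - entropy2 b <= (b - a) ^+ 2 / (a * (1 - a)).
Proof.
move=> /andP[b0 b1] /andP[a0 a1]; rewrite /entropy2.
have a1' : 0 < 1 - a by lra.
have b1' : 0 < 1 - b by lra.
have h1 := ler_wpM2l (ltW b0) (ln_le_sub1 (divr_gt0 b0 a0)).
have h2 := ler_wpM2l (ltW b1') (ln_le_sub1 (divr_gt0 b1' a1')).
rewrite ln_div_pos// in h1; rewrite ln_div_pos// in h2.
have -> : (b - a) ^+ 2 / (a * (1 - a)) =
    b * (b / a - 1) + (1 - b) * ((1 - b) / (1 - a) - 1).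
  by field; rewrite !gt_eqF.
lra.
Qed.

Lemma expect_bernoulli S v f g : measurable_wrt S f -> measurable_wrt S g ->
  expect P (fun A => if v \in A then f A else g A) =
  expect P (fun A => cexp P S (ind v) A * f A + (1 - cexp P S (ind v) A) * g A).
Proof.
move=> fS gS; rewrite -(expect_cexp P_gt0 P_sum1 S); apply: expect_ext => A.
rewrite (@cexp_eq _ _ _ S _ (fun B => (f A - g A) * ind v B + g A)); last first.
  move=> B BA; rewrite (fS _ _ BA) (gS _ _ BA) /ind.
  by case: (v \in B) => /=; rewrite ?mulr1 ?mulr0; ring.
by rewrite cexpD cexpZ cexp_cst//; ring.
Qed.

Lemma centropyE v S : v \notin S ->
  centropy v S = expect P (fun A => entropy2 (cexp P S (ind v) A)).
Proof.
move=> vS; rewrite /centropy /entropy -expectB//.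
pose p := cexp P S (ind v); have pm : measurable_wrt S p by exact: cexp_meas.
rewrite (@expect_ext _ _ _ _ (fun A => if v \in A then - ln (p A) else - ln (1 - p A))); last first.
  move=> A; rewrite marg_setU1//.
  have p0 := cexp_ind_gt0 P_gt0 A vS; have p1 := cexp_ind_lt1 P_gt0 A vS.
  case: ifP => _; rewrite ln_prod_pos ?subr_gt0 ?marg_gt0//; rewrite /p; ring.
rewrite (@expect_bernoulli S); last 2 first.
- by move=> A B AB; rewrite (pm _ _ AB).
- by move=> A B AB; rewrite (pm _ _ AB).
by apply: expect_ext => A; rewrite /entropy2 /p; ring.
Qed.

Lemma centropy_mem v S : v \in S -> centropy v S = 0.
Proof. by move=> vS; rewrite /centropy (setUidPr _) ?sub1set// subrr. Qed.

Lemma centropy_ge0 v S : 0 <= centropy v S.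
Proof.
have [vS|vS] := boolP (v \in S); first by rewrite centropy_mem.
rewrite centropyE// -(expect_cst P_gt0 P_sum1 0); apply: expect_le => // A.
by apply: entropy2_ge0; rewrite cexp_ind_ge0 ?cexp_ind_le1.
Qed.

Lemma centropy_le_ln2 v S : centropy v S <= ln 2.
Proof.
have [vS|vS] := boolP (v \in S).
  by rewrite centropy_mem// ltW// ln_gt0// ltr1n.
rewrite centropyE// -(expect_cst P_gt0 P_sum1 (ln 2)); apply: expect_le => // A.
by apply: entropy2_le_ln2; rewrite cexp_ind_gt0 ?cexp_ind_lt1.
Qed.

(** The cross entropy is affine in the probability given [Y], whose conditional expectation given
    [X] is the probability given [X]. *)
Lemma expect_cross v X Y : X \subset Y -> v \notin X ->
  expect P (fun A => entropy2 (cexp P X (ind v) A)) =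
  expect P (fun A => - (cexp P Y (ind v) A * ln (cexp P X (ind v) A))
    - (1 - cexp P Y (ind v) A) * ln (1 - cexp P X (ind v) A)).
Proof.
move=> XY vX; rewrite -[RHS](expect_cexp P_gt0 P_sum1 X); apply: expect_ext => A.
set a := cexp P X (ind v) A.
rewrite (@cexp_eq _ _ _ X _
  (fun B => (ln (1 - a) - ln a) * cexp P Y (ind v) B + - ln (1 - a))); last first.
  by move=> B BA; rewrite (cexp_meas _ _ BA) -/a; ring.
by rewrite cexpD cexpZ cexp_cst// cexp_tower// -/a /entropy2; ring.
Qed.

Lemma centropy_anti v X Y : X \subset Y -> centropy v Y <= centropy v X.
Proof.
move=> XY; have [vY|vY] := boolP (v \in Y).
  by rewrite (centropy_mem vY) centropy_ge0.
have vX : v \notin X by apply: contra vY; apply/subsetP.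
rewrite !centropyE// (expect_cross XY vX); apply: expect_le => // A.
apply: entropy2_cross; first by rewrite cexp_ind_ge0// cexp_ind_le1.
by rewrite cexp_ind_gt0// cexp_ind_lt1.
Qed.

Lemma entropy_setU_le S X : entropy (X :|: S) <= entropy S + #|X|%:R * ln 2.
Proof.
have [n] := ubnP #|X|; elim: n X => // n IH X; rewrite ltnS => Xn.
have [->|[v vX]] := set_0Vmem X; first by rewrite set0U cards0 mul0r addr0.
have cX : #|X| = #|X :\ v|.+1 by rewrite (cardsD1 v) vX.
have := IH (X :\ v) ltac:(by rewrite -cX).
have := centropy_le_ln2 v ((X :\ v) :|: S).
rewrite /centropy setUA (setD1K vX) cX -[_.+1]addn1 natrD; lra.
Qed.

Lemma entropy_set0 : entropy set0 = 0.
Proof.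
rewrite /entropy -(expect_cst P_gt0 P_sum1 0); apply: expect_ext => A.
by rewrite marg0// ln1 oppr0.
Qed.

Lemma marg_setT A : marg P setT A = P A.
Proof. by rewrite /marg (big_pred1 A)// => B; rewrite !setIT. Qed.

(** * Finite energy and the comparison of mutual information with covariance *)

Context (K : R).
Context (K_gt0 : 0 < K).
Context (P_flip : forall B v, v \notin B -> P B <= K * P (v |: B) /\ P (v |: B) <= K * P B).

(** Flipping [v], which is not in [S], exchanges the two halves of a conditioning class and changes
    masses by a factor of at most [K]. *)
Lemma finite_energy S v A : v \notin S ->
  1 <= (1 + K) * cexp P S (ind v) A /\ 1 <= (1 + K) * (1 - cexp P S (ind v) A).
Proof.
move=> vS; have M := marg_gt0 P_gt0 S A.
set M1 := \sum_(B : {set T} | (B :&: S == A :&: S) && (v \in B)) P B.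
set M0 := \sum_(B : {set T} | (B :&: S == A :&: S) && (v \notin B)) P B.
have MM : marg P S A = M1 + M0 by rewrite /marg (sum_class_split _ _ vS).
have pE : cexp P S (ind v) A = M1 / marg P S A.
  rewrite /cexp; congr (_ / _); rewrite /M1 [RHS]big_mkcondr; apply: eq_bigr => B _.
  by rewrite /ind; case: ifP => _; rewrite ?mulr1 ?mulr0.
have M1E : M1 = \sum_(B : {set T} | (B :&: S == A :&: S) && (v \notin B)) P (v |: B).
  rewrite /M1 (reindex_onto (fun B : {set T} => v |: B) (fun B => B :\ v)) /=; last first.
    by move=> B /andP[_ vB]; rewrite setD1K.
  apply: eq_bigl => B; rewrite setU11 andbT setI_U1l//; congr (_ && _).
  apply/eqP/idP => [<-|vB]; first by rewrite !inE eqxx.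
  by rewrite setU1K.
have h1 : M0 <= K * M1.
  by rewrite M1E mulr_sumr; apply: ler_sum => B /andP[_ vB]; case: (P_flip vB).
have h2 : M1 <= K * M0.
  by rewrite {1}M1E mulr_sumr; apply: ler_sum => B /andP[_ vB]; case: (P_flip vB).
rewrite pE; split.
  rewrite mulrA ler_pdivlMr// mul1r MM; lra.
have -> : 1 - M1 / marg P S A = M0 / marg P S A by rewrite MM; field; rewrite -MM marg_neq0.
rewrite mulrA ler_pdivlMr// mul1r MM; lra.
Qed.

Lemma var_ind_lb S v A : v \notin S ->
  1 <= (1 + K) ^+ 2 * cov P S (ind v) (ind v) A.
Proof.
move=> vS; rewrite var_ind; have [h1 h2] := finite_energy A vS.
have -> : (1 + K) ^+ 2 * (cexp P S (ind v) A * (1 - cexp P S (ind v) A)) =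
  ((1 + K) * cexp P S (ind v) A) * ((1 + K) * (1 - cexp P S (ind v) A)) by ring.
by rewrite -[leLHS]mulr1; apply: ler_pM.
Qed.

(** The mutual information is a mean relative entropy, hence at most a chi-square divergence. The
    conditional variances of [v] and [u] in the denominators are each at least [(1 + K) ^- 2], which
    gives the fourth power. *)
Lemma mutual_info_le_cov S u v : u != v ->
  centropy v S - centropy v (u |: S) <=
  (1 + K) ^+ 4 * expect P (fun A => cov P S (ind v) (ind u) A ^+ 2).
Proof.
move=> uv; have rhs0 : 0 <= (1 + K) ^+ 4 * expect P (fun A => cov P S (ind v) (ind u) A ^+ 2).
  apply: mulr_ge0; first by apply: exprn_ge0; have := K_gt0; lra.
  by rewrite -(expect_cst P_gt0 P_sum1 0); apply: expect_le => // A; exact: sqr_ge0.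
have [uS|uS] := boolP (u \in S).
  by rewrite (setUidPr _) ?sub1set// subrr.
have [vS|vS] := boolP (v \in S).
  by rewrite !centropy_mem// ?subrr// !inE vS orbT.
have vuS : v \notin u |: S by rewrite !inE negb_or eq_sym uv.
have SuS : S \subset u |: S by exact: subsetUr.
rewrite !centropyE// (expect_cross SuS vS) -expectB//.
rewrite -(expectZ P_sum1).
apply: (@le_trans _ _ (expect P (fun A => (1 + K) ^+ 2 *
   (cexp P (u |: S) (ind v) A - cexp P S (ind v) A) ^+ 2))).
  apply: expect_le => // A.
  have a0 := cexp_ind_gt0 P_gt0 A vS; have a1 := cexp_ind_lt1 P_gt0 A vS.
  have b0 := cexp_ind_gt0 P_gt0 A vuS; have b1 := cexp_ind_lt1 P_gt0 A vuS.
  apply: le_trans (entropy2_gap (introT andP (conj b0 b1)) (introT andP (conj a0 a1))) _.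
  have := var_ind_lb A vS; rewrite var_ind => h.
  set a := cexp P S (ind v) A in a0 a1 h *; set b := cexp P _ _ A.
  have aa : 0 < a * (1 - a) by rewrite mulr_gt0// subr_gt0.
  rewrite ler_pdivrMr//.
  have -> : (1 + K) ^+ 2 * (b - a) ^+ 2 * (a * (1 - a)) =
    ((1 + K) ^+ 2 * (a * (1 - a))) * (b - a) ^+ 2 by ring.
  by rewrite ler_peMl ?sqr_ge0.
rewrite -(expect_cexp P_gt0 P_sum1 S); apply: expect_le => // A.
set c := cov P S (ind v) (ind u) A.
pose V := cov P S (ind u) (ind u) A.
have V1 := var_ind_lb A uS; rewrite -/V in V1.
have V0 : 0 < V.
  rewrite ltNge; apply/negP => Vn.
  have := mulr_ge0 (sqr_ge0 (1 + K)) (_ : 0 <= - V); rewrite oppr_ge0 => /(_ Vn).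
  by rewrite mulrN; lra.
(* Revealing [u] moves the probability of [v] by [c / V] times the centred spin of [u], whose
   conditional variance is [V]. *)
rewrite (@cexp_eq _ _ _ S _ (fun B => (1 + K) ^+ 2 * (c / V) ^+ 2 *
    (ind u B - cexp P S (ind u) A) ^+ 2)); last first.
  move=> B BA; rewrite cexp_setU1// addrAC subrr add0r exprMn mulrA.
  by rewrite (cexp_meas _ _ BA) {1 2}/cov !(cexp_meas _ _ BA).
rewrite cexpZ cexp_sqr_sub// subrr expr0n addr0 -/V.
have -> : (1 + K) ^+ 2 * (c / V) ^+ 2 * V = (1 + K) ^+ 2 * c ^+ 2 / V.
  by field; rewrite gt_eqF.
rewrite ler_pdivrMr//.
have -> : (1 + K) ^+ 4 * c ^+ 2 * V = (1 + K) ^+ 2 * c ^+ 2 * ((1 + K) ^+ 2 * V) by ring.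
by rewrite ler_peMr// mulr_ge0 ?sqr_ge0.
Qed.

End Entropy.

(** * Sampling vertices *)

Section Sampling.
Context {R : realType} {T : finType}.
Context (T_gt0 : (0 < #|T|)%N).
Implicit Types (f g : T -> R) (phi psi : seq T -> R).

Local Notation n := (#|T|%:R : R).

Let n_gt0 : 0 < n. Proof. by rewrite ltr0n. Qed.

Definition mean f : R := (\sum_v f v) / n.

Lemma mean_le f g : (forall v, f v <= g v) -> mean f <= mean g.
Proof. by move=> fg; rewrite ler_pM2r ?invr_gt0//; exact: ler_sum. Qed.

Lemma meanD f g : mean (fun v => f v + g v) = mean f + mean g.
Proof. by rewrite /mean big_split mulrDl. Qed.

Lemma meanZ c f : mean (fun v => c * f v) = c * mean f.
Proof. by rewrite /mean -mulr_sumr mulrA. Qed.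

Lemma mean_cst c : mean (fun=> c) = c.
Proof. by rewrite /mean sumr_const -[c *+ _]mulr_natr mulfK// gt_eqF. Qed.

Fixpoint sample_mean j phi : R :=
  if j is i.+1 then mean (fun v => sample_mean i (fun s => phi (v :: s)))
  else phi [::].

Lemma sample_mean_le j phi psi : (forall s, size s = j -> phi s <= psi s) ->
  sample_mean j phi <= sample_mean j psi.
Proof.
elim: j phi psi => [|j IH] phi psi h /=; first exact: h.
by apply: mean_le => v; apply: IH => s sj; apply: h; rewrite /= sj.
Qed.

Lemma sample_mean_ext j phi psi : (forall s, size s = j -> phi s = psi s) ->
  sample_mean j phi = sample_mean j psi.
Proof.
by move=> h; apply/eqP; rewrite eq_le !sample_mean_le// => s sj; rewrite h.
Qed.

Lemma sample_meanD j phi psi :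
  sample_mean j (fun s => phi s + psi s) = sample_mean j phi + sample_mean j psi.
Proof.
elim: j phi psi => [//|j IH] phi psi /=; rewrite -meanD /mean; congr (_ / _).
by apply: eq_bigr => v _; exact: IH.
Qed.

Lemma sample_meanZ j c phi :
  sample_mean j (fun s => c * phi s) = c * sample_mean j phi.
Proof.
elim: j phi => [//|j IH] phi /=; rewrite -meanZ /mean; congr (_ / _).
by apply: eq_bigr => v _; exact: IH.
Qed.

Lemma sample_mean_cst j c : sample_mean j (fun=> c) = c.
Proof.
elim: j => [//|j IH] /=; rewrite -[RHS]mean_cst /mean; congr (_ / _).
by apply: eq_bigr.
Qed.

Lemma sample_mean_sum j (I : Type) (r : seq I) (F : I -> seq T -> R) :
  sample_mean j (fun s => \sum_(i <- r) F i s) = \sum_(i <- r) sample_mean j (F i).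
Proof.
elim: r => [|i r IH].
  rewrite big_nil -[RHS](sample_mean_cst j 0); apply: sample_mean_ext => s _.
  by rewrite big_nil.
rewrite big_cons -IH -sample_meanD; apply: sample_mean_ext => s _.
by rewrite big_cons.
Qed.

(** The recursion averages over the head of the list outermost, this form innermost: the head
    becomes the vertex revealed last. *)
Lemma sample_meanS j phi :
  sample_mean j.+1 phi = sample_mean j (fun s => mean (fun v => phi (v :: s))).
Proof.
rewrite /= /mean mulrC -sample_mean_sum -sample_meanZ.
by apply: sample_mean_ext => s _; rewrite mulrC.
Qed.

Lemma sample_variance j (c : T -> R) : \sum_v c v = 0 ->
  sample_mean j (fun s => (\sum_(u <- s) c u) ^+ 2) = j%:R * mean (fun v => c v ^+ 2).
Proof.
move=> c0; elim: j => [|j IH]; first by rewrite /= big_nil expr0n mul0r.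
rewrite sample_meanS (@sample_mean_ext _ _
  (fun s => (\sum_(u <- s) c u) ^+ 2 + mean (fun v => c v ^+ 2))); last first.
  move=> s _; rewrite (_ : (fun v => _) = (fun v => c v ^+ 2 +
    (2 * (\sum_(u <- s) c u) * c v + (\sum_(u <- s) c u) ^+ 2))); last first.
    by apply/funext => v; rewrite big_cons; ring.
  rewrite meanD meanD mean_cst meanZ {2}/mean c0 mul0r mulr0 add0r; exact: addrC.
by rewrite sample_meanD IH sample_mean_cst -[j.+1]addn1 natrD; ring.
Qed.

Definition seen (s : seq T) : {set T} := [set x in s].

Lemma seen_cons v s : seen (v :: s) = v |: seen s.
Proof. by apply/setP => x; rewrite !inE. Qed.

(** A draw multiplies the mean number of unseen vertices by [1 - n^-1], and [(1 - n^-1) * (1 +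
    j.+1%:R / n) <= 1 + j%:R / n]. *)
Lemma sample_unseen j :
  sample_mean j (fun s => #|~: seen s|%:R) * (1 + j%:R / n) <= n.
Proof.
have i0 : 0 < n^-1 by rewrite invr_gt0.
elim: j => [|j IH].
  by rewrite /= mul0r addr0 mulr1 ler_nat max_card.
have q0 : 0 <= sample_mean j (fun s => #|~: seen s|%:R).
  by rewrite -(sample_mean_cst j 0); apply: sample_mean_le => s _; exact: ler0n.
rewrite sample_meanS (@sample_mean_ext _ _ (fun s => (1 - n^-1) * #|~: seen s|%:R)); last first.
  move=> s _; rewrite (_ : (fun v => _) =
     (fun v => #|~: seen s|%:R + (-1) * (v \in ~: seen s)%:R)); last first.
    apply/funext => v; rewrite seen_cons [in RHS](cardsD1 v (~: seen s)) natrD.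
    rewrite (_ : ~: (v |: seen s) = (~: seen s) :\ v); first ring.
    by apply/setP => x; rewrite !inE negb_or.
  rewrite meanD mean_cst meanZ /mean -natr_sum (_ : \sum_v _ = #|~: seen s|); first by ring.
  by rewrite -sum1_card [RHS]big_mkcond; apply: eq_bigr => v _; case: (v \in _).
rewrite sample_meanZ; apply: le_trans IH.
set q := sample_mean _ _ in q0 *.
have -> : (1 - n^-1) * q * (1 + j.+1%:R / n) =
    q * (1 + j%:R / n) - q * (n^-1 * (j%:R / n) + n^-1 * n^-1).
  by rewrite -[j.+1]addn1 natrD; ring.
rewrite gerBl mulr_ge0// addr_ge0// !mulr_ge0// ltW.
Qed.

Lemma sample_drift (Psi : {set T} -> R) c j i :
  (forall S, mean (fun v => Psi (v |: S)) <= Psi S + c) ->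
  sample_mean (i + j) (fun s => Psi (seen s)) <=
  sample_mean j (fun s => Psi (seen s)) + i%:R * c.
Proof.
move=> h; elim: i => [|i IH]; first by rewrite add0n mul0r addr0.
rewrite addSn sample_meanS.
apply: (@le_trans _ _ (sample_mean (i + j) (fun s => Psi (seen s) + c))).
  apply: sample_mean_le => s _; apply: le_trans (h (seen s)).
  by apply: mean_le => v; rewrite seen_cons.
rewrite sample_meanD sample_mean_cst -[i.+1]addn1 natrD; lra.
Qed.

Context (P : {set T} -> R).
Context (P_gt0 : forall A, 0 < P A).
Context (P_sum1 : \sum_A P A = 1).

Definition total (A : {set T}) : R := #|A|%:R.

Lemma totalE A : total A = \sum_v ind v A.
Proof.
rewrite /total -sum1_card natr_sum big_mkcond; apply: eq_bigr => v _.
by rewrite /ind; case: (v \in A).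
Qed.

Lemma expect_var_le S (f g : {set T} -> R) : measurable_wrt S g ->
  expect P (cov P S f f) <= expect P (fun A => (f A - g A) ^+ 2).
Proof.
move=> gm; rewrite -[leRHS](expect_cexp P_gt0 P_sum1 S).
apply: expect_le => // A; apply: le_trans (var_le_sqr P_gt0 _ _ (g A) _) _.
rewrite le_eqVlt; apply/orP; left; apply/eqP; apply: cexp_eq => B BA.
by rewrite (gm _ _ BA).
Qed.

(* Given the spins of j sampled vertices, the rescaled sample sum is an unbiased
   estimate of the total, so its sampling error bounds the conditional variance. *)
Lemma sample_total_variance j : (0 < j)%N ->
  sample_mean j (fun s => expect P (cov P (seen s) total total)) <= n ^+ 2 / j%:R.
Proof.
move=> j0; have j0' : 0 < j%:R :> R by rewrite ltr0n.
pose g (s : seq T) (A : {set T}) : R := n / j%:R * \sum_(u <- s) ind u A.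
have key : sample_mean j (fun s => expect P (cov P (seen s) total total)) <=
    sample_mean j (fun s => \sum_A P A * (total A - g s A) ^+ 2).
  apply: sample_mean_le => s _; apply: expect_var_le => A B AB; rewrite /g; congr (_ * _).
  rewrite big_seq [RHS]big_seq; apply: eq_bigr => u us.
  by apply: (@ind_meas _ _ (seen s)) AB; rewrite inE.
apply: le_trans key _; rewrite sample_mean_sum -[leRHS](expect_cst P_gt0 P_sum1).
apply: ler_sum => A _.
rewrite sample_meanZ ler_wpM2l ?(ltW (P_gt0 _))//.
(* Once centred at [m], the error of the estimate is a rescaled sum of independent centred terms. *)
pose m := total A / n; pose c u := ind u A - m.
have c0 : \sum_u c u = 0.
  by rewrite sumrB -totalE sumr_const -[m *+ _]mulr_natr /m divfK ?subrr// gt_eqF.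
rewrite (@sample_mean_ext _ _ (fun s => (n / j%:R) ^+ 2 * (\sum_(u <- s) c u) ^+ 2)); last first.
  move=> s sj; rewrite -exprMn -sqrrN opprB; congr (_ ^+ 2).
  rewrite /g sumrB mulrBr; congr (_ - _).
  by rewrite big_const_seq count_predT sj iter_addr_0 -mulr_natr /m; field; rewrite !gt_eqF.
rewrite sample_meanZ sample_variance// -[leRHS]mulr1.
have -> : (n / j%:R) ^+ 2 * (j%:R * mean (fun v => c v ^+ 2)) =
    n ^+ 2 / j%:R * mean (fun v => c v ^+ 2) by field; rewrite gt_eqF.
rewrite ler_wpM2l//.
rewrite -[leRHS]mean_cst; apply: mean_le => v; rewrite /c.
have m0 : 0 <= m by rewrite divr_ge0 ?ler0n.
have m1 : m <= 1 by rewrite ler_pdivrMr// mul1r ler_nat max_card.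
by rewrite /ind; case: (v \in A) => /=; nra.
Qed.

End Sampling.

(** * Balls, girth and the Markov property *)

Section Balls.
Context {T F : finType}.
Context (N : F -> {set T}).
Implicit Types (u v : T) (f : F) (r m l : nat).

(** A step passes through a factor, so radius [r] corresponds to distance [2 r] in the bipartite
    graph. *)
Fixpoint ball v r : {set T} :=
  if r is r'.+1 then
    ball v r' :|: [set u | [exists f, (u \in N f) && (N f :&: ball v r' != set0)]]
  else [set v].

Lemma ballS v r : ball v r \subset ball v r.+1.
Proof. exact: subsetUl. Qed.

Lemma ball_le v r m : (r <= m)%N -> ball v r \subset ball v m.
Proof.
move=> /subnK <-; elim: (m - r)%N => [|i IH]; first by rewrite add0n.
by rewrite addSn; exact: subset_trans IH (ballS _ _).
Qed.

Lemma ball_center v r : v \in ball v r.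
Proof. by apply: (subsetP (ball_le v (leq0n r))); rewrite inE. Qed.

Lemma ball_factor v r f u : u \in N f -> u \in ball v r -> N f \subset ball v r.+1.
Proof.
move=> uf ur; apply/subsetP => x xf; rewrite !inE; apply/orP; right.
by apply/existsP; exists f; rewrite xf; apply/set0Pn; exists u; rewrite inE uf.
Qed.

Lemma ballSP v r u : u \in ball v r.+1 -> u \notin ball v r ->
  exists f u', [/\ u \in N f, u' \in N f & u' \in ball v r].
Proof.
rewrite !inE => /orP[->//|/existsP[f /andP[uf /set0Pn[u']]]].
by rewrite inE => /andP[u'f u'r] _; exists f, u'.
Qed.

Lemma ball_layer v m u : u \in ball v m -> u != v ->
  exists2 r, (r < m)%N & (u \in ball v r.+1) && (u \notin ball v r).
Proof.
elim: m => [|m IH]; first by rewrite inE => ->.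
move=> um uv; have [um'|um'] := boolP (u \in ball v m).
  by have [r rm h] := IH um' uv; exists r => //; exact: leqW.
by exists m; rewrite ?um.
Qed.

(* A vertex u at distance r.+1 <= l from v has at most one factor containing
   another vertex at distance at most r.+1. *)
Definition tree_like l := forall v r u f f', (r < l)%N ->
  u \in ball v r.+1 -> u \notin ball v r -> u \in N f -> u \in N f' ->
  (exists u', [/\ u' \in N f, u' != u & u' \in ball v r.+1]) ->
  (exists u', [/\ u' \in N f', u' != u & u' \in ball v r.+1]) -> f = f'.

(* u is the only vertex of f at minimal distance from v. *)
Definition parent v l u f := [exists m : 'I_l.+1, N f :&: ball v m == [set u]].

Lemma parent_mem v l u f : parent v l u f -> u \in N f.
Proof.
by move=> /existsP[m /eqP/setP/(_ u)]; rewrite !inE eqxx => /andP[].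
Qed.

Lemma parent_uniq v l u1 u2 f : parent v l u1 f -> parent v l u2 f -> u1 = u2.
Proof.
move=> /existsP[m1 /eqP h1] /existsP[m2 /eqP h2].
wlog m12 : u1 u2 m1 m2 h1 h2 / (m1 <= m2)%N => [H|].
  have [m12|m21] := leqP m1 m2; first exact: H h1 h2 m12.
  by apply/esym; exact: H h2 h1 (ltnW m21).
have : u1 \in N f :&: ball v m1 by rewrite h1 inE.
rewrite inE => /andP[u1f u1m]; have : u1 \in N f :&: ball v m2.
  by rewrite inE u1f (subsetP (ball_le v m12)).
by rewrite h2 inE => /eqP.
Qed.

Lemma parent_center v l f : v \in N f -> parent v l v f.
Proof.
move=> vf; apply/existsP; exists ord0 => /=; apply/eqP/setP => x; rewrite !inE.
by case: eqP => [->|]; rewrite ?vf ?andbF.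
Qed.

(** If [u] first appears at radius [r.+1], any factor of [u] that it does not dominate contains
    another vertex of that ball. By [tree_like] there is at most one such factor. *)
Lemma card_parent v l d u : tree_like l -> #|[set f | u \in N f]| = d ->
  u \in ball v l -> u != v -> (d.-1 <= #|[set f | parent v l u f]|)%N.
Proof.
move=> tl du ul uv; have [r rl /andP[ur ur']] := ball_layer ul uv.
pose bad := [set f | (u \in N f) && ~~ parent v l u f].
have badP f : f \in bad -> exists u', [/\ u' \in N f, u' != u & u' \in ball v r.+1].
  rewrite inE => /andP[uf /existsPn/(_ (Ordinal (rl : (r.+1 < l.+1)%N))) /= nE].
  have /subsetPn[u' ] : ~~ (N f :&: ball v r.+1 \subset [set u]).
    apply: contra nE => h; rewrite eqEsubset h sub1set inE uf; exact: ur.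
  by move=> /setIP[u'f u'r]; rewrite inE => u'u; exists u'.
have bad1 : (#|bad| <= 1)%N.
  apply/card_le1P => f fb f'; apply/idP/idP => [fb'|/eqP ->//].
  have fbN : u \in N f by move: fb; rewrite inE => /andP[].
  have fbN' : u \in N f' by move: fb'; rewrite inE => /andP[].
  by apply/eqP/esym/(tl v r u f f') => //; exact: badP.
have -> : d.-1 = (d - 1)%N by rewrite subn1.
rewrite leq_subLR -du; apply: leq_trans (_ : #|bad :|: [set f | parent v l u f]| <= _)%N.
  by apply/subset_leq_card/subsetP => f; rewrite !inE => ->; rewrite orNb.
by apply: leq_trans (leq_card_setU _ _) _; rewrite leq_add2r.
Qed.

(** Each layer is nonempty: of two factors at a vertex [u] of the last layer, [tree_like] leaves
    one, [f0], whose other vertices are all new. *)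
Lemma ball_card v l d k : tree_like l -> (2 <= d)%N -> (2 <= k)%N ->
  (forall u, #|[set f | u \in N f]| = d) -> (forall f, #|N f| = k) ->
  (l < #|ball v l|)%N.
Proof.
move=> tl d2 k2 du kf.
have other f u : u \in N f -> exists2 u', u' \in N f & u' != u.
  move=> uf; have : (0 < #|N f :\ u|)%N.
    by rewrite -(ltn_add2l (u \in N f)) -cardsD1 kf uf.
  by rewrite card_gt0 => /set0Pn[u']; rewrite !inE => /andP[h1 h2]; exists u'.
have step r : (r < l)%N -> exists u, (u \in ball v r.+1) && (u \notin ball v r).
  elim: r => [|r IH] rl.
    have : (0 < #|[set f | v \in N f]|)%N by rewrite du (leq_trans _ d2).
    rewrite card_gt0 => /set0Pn[f]; rewrite inE => vf.
    have [u uf uv] := other f v vf; exists u.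
    by rewrite (subsetP (ball_factor vf (ball_center v 0)) _ uf) inE uv.
  have [u /andP[ur ur']] := IH (ltnW rl).
  have /card_gt1P[f [f' [fu f'u ff']]] : (1 < #|[set f | u \in N f]|)%N by rewrite du.
  rewrite !inE in fu f'u.
  have [f0 f0u f0n] : exists2 f0, u \in N f0 &
      forall u', u' \in N f0 -> u' != u -> u' \notin ball v r.+1.
    have [/existsP[u1 /and3P[h1 h2 h3]]|/existsPn nf] :=
      boolP [exists u', [&& u' \in N f, u' != u & u' \in ball v r.+1]]; last first.
      exists f => // u' u'f u'u; have := nf u'; by rewrite u'f u'u.
    have [/existsP[u2 /and3P[g1 g2 g3]]|/existsPn nf'] :=
      boolP [exists u', [&& u' \in N f', u' != u & u' \in ball v r.+1]]; last first.
      exists f' => // u' u'f u'u; have := nf' u'; by rewrite u'f u'u.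
    case/eqP: ff'; apply: (tl v r u) => //; first exact: ltnW.
      by exists u1.
    by exists u2.
  have [u' u'f u'u] := other f0 u f0u; exists u'.
  by rewrite (subsetP (ball_factor f0u ur) _ u'f) (f0n _ u'f u'u).
suff H r : (r <= l)%N -> (r < #|ball v r|)%N by exact: H.
elim: r => [|r IH] rl; first by rewrite cards1.
have [u /andP[ur ur']] := step r rl.
apply: leq_ltn_trans (IH (ltnW rl)) _; apply: proper_card.
rewrite properE ballS; apply/subsetPn; by exists u.
Qed.

(** Each factor is charged to its parent, which is unique. Exchanging the sums then counts the
    factors charged to [u]: all [d] for the centre, at least [d - 1] elsewhere. *)
Lemma sum_parents (R : realFieldType) v l d (g : T -> R) (G : F -> R) :
  tree_like l -> (1 <= d)%N -> (forall u, #|[set f | u \in N f]| = d) ->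
  (forall u, 0 <= g u) -> (forall f, 0 <= G f) ->
  (forall f u, u \in N f -> g u <= G f) ->
  d%:R * g v + (d%:R - 1) * \sum_(u in ball v l | u != v) g u <= \sum_f G f.
Proof.
move=> tl d1 du g0 G0 gG.
apply: (@le_trans _ _ (\sum_f \sum_(u in ball v l | parent v l u f) g u)); last first.
  apply: ler_sum => f _.
  have [/existsP[u uf]|/existsPn nf] := boolP [exists u, parent v l u f]; last first.
    by rewrite big1// => u; rewrite (negbTE (nf u)) andbF.
  have [ul|ul] := boolP (u \in ball v l).
    rewrite (bigD1 u) ?ul//= big1 ?addr0; first exact/gG/(parent_mem uf).
    by move=> u' /andP[/andP[_ u'f]]; rewrite (parent_uniq u'f uf) eqxx.
  rewrite big1// => u' /andP[u'l u'f].
  by move: ul; rewrite -(parent_uniq u'f uf) u'l.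
rewrite (exchange_big_dep (fun u => u \in ball v l)) /=; last by move=> f u _ /andP[].
have E u : u \in ball v l -> \sum_(f | (u \in ball v l) && parent v l u f) g u =
    #|[set f | parent v l u f]|%:R * g u.
  move=> ul; rewrite ul sumr_const mulr_natl; congr (_ *+ _).
  by apply: eq_card => f; rewrite !inE.
rewrite (eq_bigr _ E) [X in _ <= X](bigD1 v) ?ball_center//= lerD//.
  rewrite ler_wpM2r// ler_nat -(du v); apply/subset_leq_card/subsetP => f.
  by rewrite !inE; exact: parent_center.
rewrite mulr_sumr; apply: ler_sum => u /andP[ul uv]; rewrite ler_wpM2r//.
rewrite -(natrB _ d1) ler_nat subn1; exact: card_parent.
Qed.

End Balls.

(** * The Markov property of balls *)

Section Markov.
Context {R : realType} {T F : finType}.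
Context (N : F -> {set T}) (w : nat -> R) (c : R).
Implicit Types (A B S : {set T}).

Let P A : R := c * \prod_f w #|A :&: N f|.

Context (P_gt0 : forall A, 0 < P A).

Lemma markov_ball S v r :
  measurable_wrt (S :|: (ball N v r.+1 :\: ball N v r))
    (cexp P (S :|: ~: ball N v r) (ind v)).
Proof.
move=> A A' AA'; set U := ball N v r; set X := S :|: ~: U.
have agree x : x \in S :|: (ball N v r.+1 :\: U) -> (x \in A) = (x \in A').
  by move=> xY; have /setP/(_ x) := AA'; rewrite !inE in xY *; rewrite xY !andbT.
(* [glue D B] follows [B] inside the ball and [D] outside. Thus [glue A'] carries the configurations
   agreeing with [A] on [X] to those agreeing with [A'], multiplying every weight by the same
   [out A' / out A]. *)
pose glue (D B : {set T}) := (B :&: U) :|: (D :\: U).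
have glueE D B x : (x \in glue D B) = if x \in U then x \in B else x \in D.
  by rewrite !inE; case: (x \in U); rewrite ?andbT ?andbF ?orbF.
have classE D B : (B :&: X == D :&: X) ->
    (forall x, x \notin U -> (x \in B) = (x \in D)) /\
    (forall x, x \in S -> (x \in B) = (x \in D)).
  move=> /eqP/setP h; split=> x hx; have := h x; rewrite !inE hx ?orbT ?andbT//.
have touch f : N f :&: U != set0 -> N f \subset ball N v r.+1.
  by move=> /set0Pn[u]; rewrite inE => /andP[uf uU]; exact: ball_factor uf uU.
pose out D := \prod_(f | N f :&: U == set0) w #|D :&: N f|.
have w_gt0 f D : w #|D :&: N f| != 0.
  by apply/negP => /eqP w0; have := P_gt0 D; rewrite /P (bigD1 f)//= w0 mul0r mulr0 ltxx.
have out0 D : out D != 0 by rewrite /out; apply/prodf_neq0 => f _.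
have PE B : B :&: X == A :&: X -> P (glue A' B) * out A = P B * out A'.
  move=> /classE [BU BS]; rewrite /P (bigID (fun f => N f :&: U == set0)) /=.
  rewrite [in RHS](bigID (fun f => N f :&: U == set0)) /=.
  have -> : \prod_(f | N f :&: U == set0) w #|glue A' B :&: N f| = out A'.
    apply: eq_bigr => f /eqP/setP fU; congr (w #|pred_of_set _|).
    apply/setP => x; rewrite [LHS]inE [RHS]inE glueE.
    by have := fU x; rewrite !inE; case: (x \in N f); rewrite ?andbF//= => ->.
  have -> : \prod_(f | N f :&: U == set0) w #|B :&: N f| = out A.
    apply: eq_bigr => f /eqP/setP fU; congr (w #|pred_of_set _|).
    apply/setP => x; rewrite [LHS]inE [RHS]inE.
    have := fU x; rewrite !inE; case: (x \in N f); rewrite ?andbF//= => xU.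
    by rewrite BU ?xU.
  have -> : \prod_(f | N f :&: U != set0) w #|glue A' B :&: N f| =
      \prod_(f | N f :&: U != set0) w #|B :&: N f|.
    apply: eq_bigr => f /touch/subsetP fU; congr (w #|pred_of_set _|).
    apply/setP => x; rewrite [LHS]inE [RHS]inE glueE.
    have := fU x; case xf: (x \in N f); rewrite ?andbF//= !andbT => /(_ isT) xr.
    case xU : (x \in U) => //; rewrite BU ?xU//; apply/esym/agree.
    by rewrite in_setU in_setD xr xU orbT.
  ring.
have sumE (g : {set T} -> R) : (forall B, g (glue A' B) = g B) ->
    (\sum_(B : {set T} | B :&: X == A' :&: X) P B * g B) * out A =
    (\sum_(B : {set T} | B :&: X == A :&: X) P B * g B) * out A'.
  move=> gE; rewrite !mulr_suml (reindex_onto (glue A') (glue A)) /=; last first.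
    move=> B /classE [BU BS]; apply/setP => x; rewrite !glueE.
    by case xU: (x \in U) => //; rewrite BU// xU.
  apply: eq_big => [B|B].
    apply/andP/idP => [[/classE[BU BS] /eqP/setP BE]|BA].
      apply/eqP/setP => x; rewrite [LHS]inE [RHS]inE.
      case xX : (x \in X); rewrite ?andbF// !andbT.
      have := BE x; rewrite !glueE; case: ifP => xU; last by move=> ->.
      move: xX; rewrite !inE xU orbF => xS _.
      have := BS x xS; rewrite glueE xU => ->; apply/esym/agree.
      by rewrite inE xS.
    have [BU BS] := classE _ _ BA; split.
      apply/eqP/setP => x; rewrite [LHS]inE [RHS]inE glueE.
      case xX : (x \in X); rewrite ?andbF// !andbT; case: ifP => // xU.
      move: xX; rewrite !inE xU orbF => xS; rewrite BS//; apply/agree.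
      by rewrite inE xS.
    apply/eqP/setP => x; rewrite !glueE; case xU: (x \in U) => //.
    by rewrite BU// xU.
  rewrite gE => /andP[/classE[BU BS] /eqP/setP BE].
  have BA : B :&: X == A :&: X.
    apply/eqP/setP => x; rewrite [LHS]inE [RHS]inE.
    case xX : (x \in X); rewrite ?andbF// !andbT.
    have := BE x; rewrite !glueE; case: ifP => xU; last by move=> ->.
    move: xX; rewrite !inE xU orbF => xS _.
    have := BS x xS; rewrite glueE xU => ->; apply/esym/agree.
    by rewrite inE xS.
  by rewrite [LHS]mulrAC (PE B BA) [LHS]mulrAC.
have E1 := sumE (fun=> 1) (fun=> erefl).
have E2 := sumE (ind v) ltac:(by move=> B; rewrite /ind glueE ball_center).
have mE D : marg P X D = \sum_(B : {set T} | B :&: X == D :&: X) P B * 1.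
  by apply: eq_bigr => B _; rewrite mulr1.
rewrite /cexp; apply/eqP; rewrite eqr_div ?marg_neq0// !mE.
apply/eqP/(mulIf (out0 A)).
rewrite -[LHS]mulrA E1 [RHS]mulrAC E2 [RHS]mulrAC -[RHS]mulrA.
by [].
Qed.

End Markov.

(** * From large girth to locally tree-like balls *)

Section Girth.
Context (G : factor_graph).
Local Notation V := (vnode G).
Local Notation node := (vnode G + fnode G)%type.
Local Notation adj := (@Defs.adjacent G).
Local Notation N := (@fnbhd G).

Lemma adj_sym : symmetric adj.
Proof. by move=> [a|a] [b|b]. Qed.

(** The path descends through the layers, with two edges for each; after its start it visits only
    vertices of smaller balls, which do not contain [u]. *)
Lemma path_to_center v u : forall m u1, u1 \in ball N v m.+1 -> u \notin ball N v m -> u1 != u ->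
  exists p, [/\ path adj (inl u1) p, last (inl u1) p = inl v,
    inl u \notin (inl u1 : node) :: p & (size p <= m.+1.*2)%N].
Proof.
have base u1 : u1 \in ball N v 0 -> u1 != u -> exists p,
    [/\ path adj (inl u1) p, last (inl u1) p = inl v,
    inl u \notin (inl u1 : node) :: p & (size p <= 0)%N].
  rewrite inE => /eqP -> uv; exists [::]; split=> //.
  by rewrite inE; apply: contra uv => /eqP[->].
(* With [m.-1] the claim includes radius 0, where the path is empty, and the induction can start
   there. *)
suff H m u1 : u1 \in ball N v m -> u \notin ball N v m.-1 -> u1 != u -> exists p,
    [/\ path adj (inl u1) p, last (inl u1) p = inl v,
    inl u \notin (inl u1 : node) :: p & (size p <= m.*2)%N].
  by move=> m u1 *; exact: H.
elim: m u1 => [|m IH] u1 u1m um u1u; first exact: base.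
have um' : u \notin ball N v m.-1.
  by apply: contra um; apply/subsetP/ball_le; rewrite leq_pred.
have [u1m'|u1m'] := boolP (u1 \in ball N v m).
  have [p [h1 h2 h3 h4]] := IH _ u1m' um' u1u; exists p; split=> //.
  by rewrite (leq_trans h4)// leq_double.
have [f [u' [u1f u'f u'm]]] := ballSP u1m u1m'.
have u'u : u' != u by apply: contraNneq um => <-.
have [p [h1 h2 h3 h4]] := IH _ u'm um' u'u.
exists (inr f :: inl u' :: p); split => /=.
- by move: u1f u'f; rewrite !inE => -> ->.
- exact: h2.
- by rewrite !inE negb_or /= (inj_eq (@inl_inj _ _)) eq_sym u1u; move: h3; rewrite !inE.
- by rewrite doubleS !ltnS.
Qed.

(** Two factors of [u] violating the property both lead back to [v] by paths avoiding [u]. Joining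
    these and closing up through [u] gives a cycle of length at most [4 * l + 4]. *)
Lemma girth_tree_like l :
  (forall c, @graph_cycle G c -> (4 * l + 8 < size c)%N) -> tree_like N l.
Proof.
move=> hg v r u f f' rl ur ur' uf uf' [u1 [u1f u1u u1r]] [u2 [u2f u2u u2r]].
apply/eqP/negPn/negP => ff'.
have [p1 [a1 b1 c1 d1]] := path_to_center u1r ur' u1u.
have [p2 [a2 b2 c2 d2]] := path_to_center u2r ur' u2u.
(* Adjacency with [u] deleted: the walk, and whatever simple path is extracted from it, then stays
   away from [u]. *)
pose e := [rel a b : node | adj a b && ((a != inl u) && (b != inl u))].
have lift x p : path adj x p -> inl u \notin x :: p -> path e x p.
  elim: p x => //= y p IH x /andP[xy yp]; rewrite !inE !negb_or => /and3P[h1 h2 h3].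
  by rewrite xy /= [x == _]eq_sym h1 [y == _]eq_sym h2 IH// inE negb_or h2.
have e_sym : symmetric e.
  by move=> a b; rewrite /= adj_sym; congr (_ && _); rewrite andbC.
have q1 := lift _ _ a1 c1; have q2 := lift _ _ a2 c2.
pose q2' := rev (belast (inl u2 : node) p2).
have q2p : path e (inl v) q2'.
  by rewrite -b2 /q2' rev_path; rewrite (eq_path (e' := e)) // => a b; rewrite e_sym.
have q2l : last (inl v) q2' = inl u2.
  by rewrite /q2' -b2; case: (p2) => [//|y p]; rewrite /= rev_cons last_rcons.
pose p : seq node := inl u1 :: (p1 ++ q2') ++ [:: inr f'].
have pp : path e (inr f) p.
  rewrite /p /= cat_path cat_path q1 b1 q2p last_cat b1 q2l /= !andbT.
  by move: u1f u2f; rewrite !inE => -> ->; rewrite !(inj_eq (@inl_inj _ _)) u1u u2u.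
have pl : last (inr f) p = inr f' by rewrite /p /= last_cat.
have ps : (size p <= 4 * l + 2)%N.
  rewrite /p /= !size_cat /q2' size_rev size_belast /=.
  move: d1 d2 rl; rewrite -!muln2; move: (size p1) (size p2) => n1 n2.
  by clear; lia.
(* The two paths to [v] may overlap, so the walk from [f] to [f'] is first reduced to a simple
   path. *)
move: pl; case/shortenP: pp => p' p'p p'u p'sub p'l.
have szp : (size p' <= size p)%N.
  by apply: uniq_leq_size; [case/andP: p'u|exact: p'sub].
have e_adj : subrel e adj by move=> a b /andP[].
have p'ne : (0 < size p')%N.
  case: (p') p'l => //= -[E]; by rewrite E eqxx in ff'.
have up' : inl u \notin (inr f : node) :: p'.
  rewrite inE /=; elim: (p') (inr f : node) p'p => //= y q IH x /andP[/and3P[_ _ yu] yq].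
  by rewrite inE negb_or eq_sym yu; exact: IH yq.
have cyc : @graph_cycle G (inl u :: inr f :: p').
  split; last by rewrite /= !ltnS.
  apply/andP; split; last by rewrite cons_uniq up'.
  rewrite /= rcons_path (sub_path e_adj p'p) p'l /=.
  by move: uf uf'; rewrite !inE => -> ->.
have := hg _ cyc; move: szp ps; rewrite /=; move: (size p) (size p') => n1 n2.
by clear; lia.
Qed.

End Girth.

(** * Homogenization and the Gibbs variational principle *)

Section Homogenization.
Context {R : realType} {T : finType}.
Context (k : nat) (w : nat -> R) (X : {set T}).
Context (k_gt0 : (0 < k)%N).
Context (X_card : #|X| = k).
Context (w_lc : log_convex_upto k w).
Implicit Types (A B Y : {set T}) (u v : T) (th : T -> R).

Definition local_pf th : R :=
  \sum_(A : {set T} | A \subset X) w #|A| * expR (\sum_(v in A) th v).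

Lemma w_pos A : A \subset X -> 0 < w #|A|.
Proof. by move=> AX; apply: w_lc.1; rewrite -X_card subset_leq_card. Qed.

Lemma local_pf_gt0 th : 0 < local_pf th.
Proof.
rewrite /local_pf (bigD1 set0) ?sub0set//= ltr_pwDl//.
  by rewrite mulr_gt0 ?expR_gt0 ?w_pos ?sub0set.
by apply: sumr_ge0 => A /andP[AX _]; rewrite mulr_ge0 ?expR_ge0// ltW// w_pos.
Qed.

Lemma local_pf_cst (t : R) : local_pf (fun=> t) = factor_pf k w t.
Proof.
rewrite -X_card factor_pfE; apply: eq_bigr => A _.
by rewrite sumr_const mulr_natl.
Qed.

(** With the other spins summed out, [local_pf] is [F0 + F1 * (x + y) + F2 * x * y] for
    [x = expR (th u)] and [y = expR (th v)]. The right side exceeds the left by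
    [(F0 * F2 - F1 ^+ 2) * (x - y) ^+ 2], and the four functions theorem gives
    [F1 ^+ 2 <= F0 * F2]. *)
Lemma local_pf_pair u v th : u \in X -> v \in X -> u != v ->
  local_pf th ^+ 2 <=
  local_pf (fun x => if x == v then th u else th x) *
  local_pf (fun x => if x == u then th v else th x).
Proof.
move=> uX vX uv; pose Y := X :\ u :\ v.
have vY : v \notin Y by rewrite !inE eqxx.
have uY : u \notin v |: Y by rewrite !inE eqxx/= andbF orbF.
have XE : X = u |: (v |: Y) by rewrite /Y !setD1K// !inE eq_sym uv.
have cX : k = (#|Y|.+2)%N.
  by rewrite -X_card XE !cardsU1 uY vY /= !add1n.
pose c A := expR (\sum_(x in A) th x).
pose Fi i := \sum_(A : {set T} | A \subset Y) w (#|A :&: Y| + i)%N * c A.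
have wY i A : (i <= 2)%N -> 0 < w (#|A :&: Y| + i)%N.
  move=> i2; apply: w_lc.1; rewrite cX -addn2 leq_add//.
  by rewrite subset_leq_card ?subsetIr.
have FF : Fi 1%N * Fi 1%N <= Fi 2 * Fi 0%N.
  apply: four_functions => [A|A|A|A|A B AY BY];
    try by rewrite mulr_ge0 ?expR_ge0// ltW// wY.
  rewrite mulrACA [X in _ <= X]mulrACA; apply: ler_pM.
  - by rewrite mulr_ge0// ltW// wY.
  - by rewrite mulr_ge0 ?expR_ge0.
  - rewrite setIUl (setIidPl AY) (setIidPl BY) -setIA (setIidPl BY) addn0.
    have h0 := cardsUI A B.
    have h1 : (#|A :&: B| <= #|A|)%N by apply/subset_leq_card/subsetIl.
    have h2 : (#|A :&: B| <= #|B|)%N by apply/subset_leq_card/subsetIr.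
    have h3 : (#|A :|: B| <= #|Y|)%N by rewrite subset_leq_card// subUset AY.
    have := @log_convex_exchange R k w #|A :&: B| (#|A| - #|A :&: B|).+1
      (#|B| - #|A :&: B|).+1 w_lc ltac:(lia).
    rewrite [X in _ <= X]mulrC; congr (w _ * w _ <= w _ * _); lia.
  - exact: log_supermodular_field.
have pfE th' : (forall x, x \in Y -> th' x = th x) ->
    local_pf th' = Fi 0%N + Fi 1%N * (expR (th' u) + expR (th' v)) +
      Fi 2 * (expR (th' u) * expR (th' v)).
  move=> thE; rewrite /local_pf XE sum_subsetU1// sum_subsetU1//.
  rewrite !mulr_suml -!big_split /=; apply: eq_bigr => A AY.
  have vA : v \notin A by apply: contra vY; apply/subsetP.
  have uvA : u \notin v |: A by apply: contra uY; apply/subsetP/setUS.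
  have uA : u \notin A by apply: contra uvA; rewrite !inE orbC => ->.
  have E : \sum_(x in A) th' x = \sum_(x in A) th x.
    by apply: eq_bigr => x xA; apply/thE/(subsetP AY).
  rewrite !big_setU1//= E !cardsU1 uvA vA uA /= !add1n (setIidPl AY) /c !expRD.
  rewrite addn0 addn1 addn2; ring.
set thu := fun x => if x == v then _ else _.
set thv := fun x => if x == u then _ else _.
have notY x : x \in Y -> (x == v) = false /\ (x == u) = false.
  by rewrite !inE => /and3P[/negbTE-> /negbTE-> _].
rewrite (pfE th)// (pfE thu); last by move=> x /notY[xv _]; rewrite /thu xv.
rewrite (pfE thv); last by move=> x /notY[_ xu]; rewrite /thv xu.
rewrite /thu /thv !eqxx (negbTE uv) [v == u]eq_sym (negbTE uv).
set x := expR (th u); set y := expR (th v).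
have : 0 <= (Fi 2 * Fi 0%N - Fi 1%N * Fi 1%N) * (x - y) ^+ 2.
  by rewrite mulr_ge0 ?sqr_ge0// subr_ge0.
move=> h; rewrite -subr_ge0; apply: le_trans h _.
rewrite le_eqVlt; apply/orP; left; apply/eqP; ring.
Qed.

(* Among the fields whose values are taken from those of th, the excess of
   k ln (local_pf) over its diagonal average is maximal at a constant field: by
   local_pf_pair, two coordinates of a maximiser may be made equal. *)
Lemma local_pf_homogenize th :
  k%:R * ln (local_pf th) <= \sum_(v in X) ln (factor_pf k w (th v)).
Proof.
have /set0Pn[v0 v0X] : X != set0 by rewrite -card_gt0 X_card.
(* Fields with values among those of [th] are indexed by self-maps of [T]; these are finitely many,
   so a maximiser exists. *)
pose D (t : {ffun T -> T}) : R :=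
  k%:R * ln (local_pf (th \o t)) - \sum_(v in X) ln (factor_pf k w (th (t v))).
pose i0 : {ffun T -> T} := [ffun x => x].
pose t0 := [arg max_(t > i0) D t]%O.
have t0max t : D t <= D t0.
  by rewrite /t0; case: arg_maxP => // m _; exact.
(* Among the maximisers, one agreeing with its value at [v0] on the most vertices is taken. Were it
   not constant on [X], [t1] would be a maximiser agreeing on more. *)
pose c (t : {ffun T -> T}) := #|[set v in X | t v == t v0]|.
have [t tM tc] : exists2 t, D t = D t0 & forall t', D t' = D t0 -> (c t' <= c t)%N.
  case: (@arg_maxnP _ t0 (fun t => D t == D t0) c) => //= t /eqP tM tc.
  by exists t => // t' /eqP; exact: tc.
have const v : v \in X -> t v = t v0.
  move=> vX; apply/eqP/negPn/negP => tv.
  have vv0 : v != v0 by apply: contraNneq tv => ->.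
  pose t1 : {ffun T -> T} := [ffun x => if x == v then t v0 else t x].
  pose t2 : {ffun T -> T} := [ffun x => if x == v0 then t v else t x].
  have D12 : 2 * D t <= D t1 + D t2.
    have v0v : v0 != v by rewrite eq_sym.
    have := local_pf_pair (th \o t) v0X vX v0v.
    have -> : (fun x => if x == v then (th \o t) v0 else (th \o t) x) = th \o t1.
      by apply/funext => x /=; rewrite ffunE; case: ifP.
    have -> : (fun x => if x == v0 then (th \o t) v else (th \o t) x) = th \o t2.
      by apply/funext => x /=; rewrite ffunE; case: ifP.
    move=> h; have {h} := ln_le_mono (exprn_gt0 2 (local_pf_gt0 (th \o t))) h.
    rewrite expr2 !ln_prod_pos ?local_pf_gt0// => h.
    have {}h := ler_wpM2l (ler0n R k) h.
    have S : \sum_(x in X) ln (factor_pf k w (th (t1 x))) +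
             \sum_(x in X) ln (factor_pf k w (th (t2 x))) =
        2 * \sum_(x in X) ln (factor_pf k w (th (t x))).
      have splitX (g : T -> R) : \sum_(x in X) g x =
          g v0 + (g v + \sum_(x in X | (x != v0) && (x != v)) g x).
        rewrite (bigD1 v0)//= [in LHS](bigD1 v) ?vX ?vv0//=; congr (_ + (_ + _)).
        by apply: eq_bigl => x; rewrite andbA.
      have Et (t' : {ffun T -> T}) : (forall x, x != v0 -> x != v -> t' x = t x) ->
         \sum_(x in X | (x != v0) && (x != v)) ln (factor_pf k w (th (t' x))) =
         \sum_(x in X | (x != v0) && (x != v)) ln (factor_pf k w (th (t x))).
        by move=> E; apply: eq_bigr => x /and3P[_ h1 h2]; rewrite E.
      rewrite !splitX !ffunE !eqxx (negbTE v0v) (negbTE vv0).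
      rewrite (Et t1); last by move=> x _ xv; rewrite ffunE (negbTE xv).
      rewrite (Et t2); last by move=> x xv _; rewrite ffunE (negbTE xv).
      ring.
    rewrite /D; lra.
  have Dt1 : D t1 = D t0.
    by apply/eqP; rewrite eq_le t0max /=; have := t0max t2; rewrite tM in D12; lra.
  have := tc _ Dt1; rewrite leqNgt => /negP; apply; apply: proper_card.
  have v0v : (v0 == v) = false by rewrite eq_sym (negbTE vv0).
  apply/properP; split.
    apply/subsetP => x; rewrite !inE !ffunE v0v => /andP[-> /eqP ->] /=.
    by case: ifP.
  by exists v; rewrite !inE vX ?ffunE ?eqxx ?v0v ?eqxx//= (negbTE tv).
have D0 : D t0 = 0.
  rewrite -tM /D; have -> : local_pf (th \o t) = factor_pf k w (th (t v0)).
    rewrite -local_pf_cst; apply: eq_bigr => A AX; congr (_ * expR _).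
    by apply: eq_bigr => v vA /=; rewrite const// (subsetP AX).
  have -> : \sum_(v in X) ln (factor_pf k w (th (t v))) =
     \sum_(v in X) ln (factor_pf k w (th (t v0))).
    by apply: eq_bigr => v vX; rewrite const.
  by rewrite sumr_const X_card mulr_natl subrr.
have := t0max i0; rewrite D0 /D.
have -> : th \o i0 = th by apply/funext => x /=; rewrite ffunE.
have -> : \sum_(v in X) ln (factor_pf k w (th (i0 v))) =
    \sum_(v in X) ln (factor_pf k w (th v)) by apply: eq_bigr => v _; rewrite ffunE.
by rewrite subr_le0.
Qed.

Context (P : {set T} -> R).
Context (P_gt0 : forall A, 0 < P A).
Context (P_sum1 : \sum_A P A = 1).

(** The fields may depend on the revealed spins. The proof is Gibbs' inequality for the spins of [X]
    given [S], relative to the local law in the fields [th]. *)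
Lemma gibbs_variational (S : {set T}) (th : T -> {set T} -> R) :
  (forall v, measurable_wrt S (th v)) ->
  entropy P (X :|: S) - entropy P S + expect P (fun A => ln (w #|A :&: X|)) +
  expect P (fun A => \sum_(v in X) th v A * cexp P S (ind v) A) <=
  expect P (fun A => ln (local_pf (th^~ A))).
Proof.
move=> thm; pose phi A := w #|A :&: X| * expR (\sum_(v in A :&: X) th v A).
have wA A : 0 < w #|A :&: X| by apply/w_pos/subsetIr.
have phi_gt0 A : 0 < phi A by rewrite mulr_gt0 ?expR_gt0.
pose L A := local_pf (th^~ A).
have Lm : measurable_wrt S L.
  move=> A B AB; congr local_pf; apply/funext => v; exact: thm.
have L_gt0 A : 0 < L A by exact: local_pf_gt0.
have -> : expect P (fun A => \sum_(v in X) th v A * cexp P S (ind v) A) =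
    expect P (fun A => \sum_(v in A :&: X) th v A).
  rewrite expect_sum// (eq_bigr (fun v => expect P (fun A => th v A * ind v A))); last first.
    by move=> v _; rewrite expect_cexpM.
  rewrite -expect_sum//; apply: expect_ext => A; rewrite [RHS]big_mkcond [LHS]big_mkcond.
  apply: eq_bigr => v _; rewrite inE /ind andbC.
  by case: (v \in X) => //=; case: (v \in A); rewrite ?mulr1 ?mulr0.
rewrite /entropy -expectB// -expectD// -expectD// -subr_le0 -expectB//.
(* The ratio of the local law [phi / L] to the conditional law of the spins of [X] given [S]. It
   suffices that its expectation is at most 1, since [ln q <= q - 1]. *)
pose q A := phi A * marg P S A / (marg P (X :|: S) A * L A).
have q_gt0 A : 0 < q A by apply: divr_gt0; apply: mulr_gt0 => //; exact: marg_gt0.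
apply: (@le_trans _ _ (expect P (fun A => q A - 1))).
  apply: expect_le => // A; apply: le_trans (ln_le_sub1 (q_gt0 A)).
  have mS := marg_gt0 P_gt0 S A; have mXS := marg_gt0 P_gt0 (X :|: S) A.
  rewrite /q (ln_div_pos (mulr_gt0 (phi_gt0 A) mS) (mulr_gt0 mXS (L_gt0 A))).
  rewrite (ln_prod_pos (phi_gt0 A) mS) (ln_prod_pos mXS (L_gt0 A)).
  rewrite (ln_prod_pos (wA A) (expR_gt0 _)) expRK -/(L A); lra.
rewrite expectB// expect_cst// subr_le0 -(expect_cexp P_gt0 P_sum1 S).
rewrite -[leRHS](expect_cst P_gt0 P_sum1); apply: expect_le => // A.
rewrite (@cexp_eq _ _ _ S _ (fun B => marg P S A / L A * (phi B / marg P (X :|: S) B))); last first.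
  move=> B BA; rewrite /q (Lm _ _ BA) (marg_meas P BA).
  by field; rewrite marg_neq0//= gt_eqF.
rewrite cexpZ /cexp.
have -> : forall x : R, marg P S A / L A * (x / marg P S A) = x / L A.
  by move=> x; field; rewrite marg_neq0//= gt_eqF.
rewrite ler_pdivrMr// mul1r.
rewrite (partition_big (fun B => B :&: X) (fun y : {set T} => y \subset X)) /=; last first.
  by move=> B _; exact: subsetIr.
apply: ler_sum => y yX; pose cond B := (B :&: S == A :&: S) && (B :&: X == y).
have -> : \sum_(B : {set T} | cond B) P B * (phi B / marg P (X :|: S) B) =
   w #|y| * expR (\sum_(v in y) th v A) * \sum_(B : {set T} | cond B) P B / marg P (X :|: S) B.
  rewrite mulr_sumr; apply: eq_bigr => B /andP[/eqP BA /eqP By].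
  rewrite /phi By (eq_bigr (fun v => th v A)); first by ring.
  by move=> v _; exact: thm.
rewrite -[leRHS]mulr1 ler_wpM2l//.
  by rewrite mulr_ge0 ?expR_ge0// ltW// w_pos.
(* A pattern [y] contradicting the revealed spins contributes nothing on the left, so in general
   only an inequality holds. *)
have [B0 c0|no] := pickP cond; last by rewrite big_pred0.
have condE B : cond B = (B :&: (X :|: S) == B0 :&: (X :|: S)).
  have /andP[/eqP h1 /eqP h2] := c0; rewrite /cond -h1 -h2.
  apply/andP/eqP => [[/eqP g1 /eqP g2]|g]; first by rewrite !setIUr g1 g2.
  have sub Y : Y \subset X :|: S -> B :&: Y = B0 :&: Y.
    by move=> h; rewrite -(setIidPr h) !setIA g.
  by split; apply/eqP/sub; rewrite ?subsetUl ?subsetUr.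
rewrite (eq_bigr (fun B => P B / marg P (X :|: S) B0)); last first.
  by move=> B; rewrite condE => /eqP h; rewrite (marg_meas P h).
rewrite -mulr_suml ler_pdivrMr ?marg_gt0// mul1r /marg.
by rewrite (eq_bigl _ _ condE).
Qed.

End Homogenization.

(** * Upper bound on the partition function *)

Section UpperBound.
Context {R : realType} {T F : finType}.
Context (N : F -> {set T}) (w : nat -> R) (d k : nat).
Context (d_ge2 : (2 <= d)%N).
Context (k_ge2 : (2 <= k)%N).
Context (T_gt0 : (0 < #|T|)%N).
Context (degree : forall v, #|[set f | v \in N f]| = d).
Context (factor_size : forall f, #|N f| = k).
Context (w_lc : log_convex_upto k w).
Implicit Types (A B S X : {set T}) (u v : T) (f : F).

Definition weight A : R := \prod_f w #|A :&: N f|.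

Definition partition_sum : R := \sum_(A : {set T}) weight A.

Definition gibbs A : R := partition_sum^-1 * weight A.

Lemma w_factor_gt0 f A : 0 < w #|A :&: N f|.
Proof. by apply: w_lc.1; rewrite -(factor_size f) subset_leq_card ?subsetIr. Qed.

Lemma weight_gt0 A : 0 < weight A.
Proof. by apply: prodr_gt0 => f _; exact: w_factor_gt0. Qed.

Lemma partition_sum_gt0 : 0 < partition_sum.
Proof.
rewrite /partition_sum (bigD1 set0)//= ltr_pwDl ?weight_gt0//.
by apply: sumr_ge0 => A _; exact/ltW/weight_gt0.
Qed.

Lemma gibbs_gt0 A : 0 < gibbs A.
Proof. by rewrite mulr_gt0 ?invr_gt0 ?partition_sum_gt0 ?weight_gt0. Qed.

Lemma gibbs_sum1 : \sum_A gibbs A = 1.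
Proof. by rewrite -mulr_sumr mulVf// gt_eqF// partition_sum_gt0. Qed.

Lemma gibbs_lsm : log_supermodular gibbs.
Proof.
apply: (@log_supermodularM _ _ (fun=> partition_sum^-1) weight) => [A|A|A B|].
- by rewrite invr_ge0 ltW ?partition_sum_gt0.
- exact/ltW/weight_gt0.
- exact: lexx.
apply: log_supermodular_prod => [f A|f]; first exact/ltW/w_factor_gt0.
by apply: log_supermodular_card w_lc _; rewrite factor_size.
Qed.

(** A crude bound for the largest ratio of two weights, avoiding maxima. *)
Definition w_ratio : R := (\sum_(i < k.+1) w i) * (\sum_(i < k.+1) (w i)^-1).

Lemma w_ratioP i j : (i <= k)%N -> (j <= k)%N -> w i <= w_ratio * w j.
Proof.
move=> ik jk; have wp := w_lc.1.
have wj := wp _ jk; rewrite -ler_pdivrMr// /w_ratio.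
have nn (m : 'I_k.+1) : 0 <= w m by apply/ltW/wp; rewrite -ltnS.
apply: ler_pM; rewrite ?invr_ge0 ?(ltW wj) ?(ltW (wp _ ik))//.
- rewrite (bigD1 (Ordinal (ik : (i < k.+1)%N)))//= lerDl.
  by apply: sumr_ge0 => m _; exact: nn.
- rewrite (bigD1 (Ordinal (jk : (j < k.+1)%N)))//= lerDl.
  by apply: sumr_ge0 => m _; rewrite invr_ge0; exact: nn.
Qed.

Lemma w_ratio_ge1 : 1 <= w_ratio.
Proof.
have := @w_ratioP 0 0 isT isT; rewrite -[leLHS]mul1r ler_pM2r//.
exact: w_lc.1.
Qed.

Lemma weight_near A B v : A :\ v = B :\ v -> weight A <= w_ratio ^+ d * weight B.
Proof.
move=> AB; rewrite -(degree v) -prodr_const big_mkcond /= /weight -big_split /=.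
apply: ler_prod => f _; rewrite ltW ?w_factor_gt0//= inE.
case: ifP => vf.
  by apply: w_ratioP; rewrite -(factor_size f) subset_leq_card ?subsetIr.
rewrite mul1r (_ : A :&: N f = B :&: N f)//; apply/setP => x; rewrite !inE.
have /setP/(_ x) := AB; rewrite !inE.
by case: eqP => [->|_ /= ->//]; rewrite vf !andbF.
Qed.

Definition flip_ratio : R := w_ratio ^+ d.

Lemma flip_ratio_gt0 : 0 < flip_ratio.
Proof. by apply: exprn_gt0; apply: lt_le_trans ltr01 w_ratio_ge1. Qed.

Lemma gibbs_flip B v : v \notin B ->
  gibbs B <= flip_ratio * gibbs (v |: B) /\ gibbs (v |: B) <= flip_ratio * gibbs B.
Proof.
move=> vB; have E : (v |: B) :\ v = B :\ v.
  by apply/setP => x; rewrite !inE; case: eqP.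
by rewrite /gibbs !(mulrCA flip_ratio); split; rewrite ler_wpM2l ?invr_ge0 ?(ltW partition_sum_gt0)//;
  apply: (@weight_near _ _ v).
Qed.

Local Notation H := (entropy gibbs).
Local Notation Hc := (centropy gibbs).
Local Notation "''E'" := (expect gibbs).
Let Pp := gibbs_gt0.
Let P1 := gibbs_sum1.

Lemma ln_partition_sum : ln partition_sum = H setT + 'E (fun A => ln (weight A)).
Proof.
rewrite /entropy -expectD// -(expect_cst Pp P1 (ln partition_sum)); apply: expect_ext => A.
rewrite marg_setT /gibbs mulrC ln_div_pos ?weight_gt0 ?partition_sum_gt0//; ring.
Qed.

Lemma entropy_mono S X : H S <= H (X :|: S).
Proof.
have [n] := ubnP #|X|; elim: n X => // n IH X; rewrite ltnS => Xn.
have [->|[v vX]] := set_0Vmem X; first by rewrite set0U.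
have cX : #|X| = #|X :\ v|.+1 by rewrite (cardsD1 v) vX.
have := IH (X :\ v) ltac:(by rewrite -cX).
have := centropy_ge0 Pp P1 v ((X :\ v) :|: S).
rewrite /centropy setUA (setD1K vX); lra.
Qed.

(** The entropy formula of a tree, with every term conditioned on the spins in [S]. *)
Definition bethe_entropy S : R :=
  \sum_f (H (N f :|: S) - H S) - (d%:R - 1) * \sum_v Hc v S.

Definition bethe_excess S : R := bethe_entropy S - (H setT - H S).

Let d1 : 0 <= d%:R - 1 :> R.
Proof. by rewrite subr_ge0 ler1n (leq_trans _ d_ge2). Qed.

(** Only unseen vertices carry conditional entropy. Each costs at most [(d - 1) * ln 2] in the
    vertex terms and [ln 2] in the true entropy. *)
Lemma bethe_excess_lb S : - (d%:R * ln 2 * #|~: S|%:R) <= bethe_excess S.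
Proof.
have h1 : 0 <= \sum_f (H (N f :|: S) - H S).
  by apply: sumr_ge0 => f _; rewrite subr_ge0 entropy_mono.
have h2 : \sum_v Hc v S <= #|~: S|%:R * ln 2.
  rewrite -sum1_card natr_sum mulr_suml [leRHS]big_mkcond; apply: ler_sum => v _.
  rewrite inE; case: ifP => /= [_|/negbFE vS]; last by rewrite centropy_mem.
  by rewrite mul1r centropy_le_ln2.
have h3 := entropy_setU_le Pp P1 S (~: S).
rewrite setUC setUCr in h3.
have h4 := ler_wpM2l d1 h2.
rewrite /bethe_excess /bethe_entropy; lra.
Qed.

Definition minfo S v u : R := Hc v S - Hc v (u |: S).

Lemma minfo_ge0 S v u : 0 <= minfo S v u.
Proof. by rewrite subr_ge0 centropy_anti// subsetUr. Qed.

(* Writing the difference with mutual informations I(v; .), every factor f has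
   I(v; f) >= I(v; u) for its vertex u closest to v; up to distance l, a vertex
   u != v is closest for at least d - 1 factors, and v for d of them. *)
Lemma bethe_excess_drop l S v : tree_like N l ->
  bethe_excess (v |: S) <=
  bethe_excess S + (d%:R - 1) * \sum_(u | u \notin ball N v l) minfo S v u.
Proof.
move=> tl.
have E : bethe_excess S - bethe_excess (v |: S) =
    \sum_f (Hc v S - Hc v (N f :|: S)) - (d%:R - 1) * \sum_u minfo S v u - Hc v S.
  have E1 : \sum_f (Hc v S - Hc v (N f :|: S)) =
      \sum_f (H (N f :|: S) - H S) - \sum_f (H (N f :|: (v |: S)) - H (v |: S)).
    rewrite -sumrB; apply: eq_bigr => f _.
    by rewrite /centropy [N f :|: (v |: S)]setUCA; ring.
  have E2 : \sum_u minfo S v u = \sum_u Hc u S - \sum_u Hc u (v |: S).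
    rewrite -sumrB; apply: eq_bigr => u _.
    by rewrite /minfo /centropy [u |: (v |: S)]setUCA; ring.
  by rewrite E1 E2 /bethe_excess /bethe_entropy {5}/centropy; ring.
have G0 f : 0 <= Hc v S - Hc v (N f :|: S).
  by rewrite subr_ge0 centropy_anti// subsetUr.
have gG f u : u \in N f -> minfo S v u <= Hc v S - Hc v (N f :|: S).
  by move=> uf; rewrite lerD2l lerN2 centropy_anti// setSU// sub1set.
have := sum_parents v tl (ltnW d_ge2) degree (minfo_ge0 S v) G0 gG.
have gv : minfo S v v = Hc v S.
  by rewrite /minfo (centropy_mem _ (setU11 v S)) subr0.
have split_sum : \sum_u minfo S v u = minfo S v v +
    \sum_(u in ball N v l | u != v) minfo S v u +
    \sum_(u | u \notin ball N v l) minfo S v u.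
  by rewrite (bigID (fun u => u \in ball N v l)) /= [in LHS](bigD1 v) ?ball_center.
rewrite split_sum gv in E; rewrite gv => h; lra.
Qed.

Definition influence S v A : R := cov gibbs S (ind v) (total (R := R)) A.

Lemma influenceE S v A : influence S v A = \sum_u cov gibbs S (ind v) (ind u) A.
Proof.
rewrite -cov_sumr//; congr (cov gibbs S _ _ A); apply/funext => B; exact: totalE.
Qed.

(* Each of the l layers of the ball separates v from u, so its correlations with
   v sum to at least the squared covariance. *)
Lemma cov_far l S v u A : u \notin ball N v l ->
  l%:R * cov gibbs S (ind v) (ind u) A ^+ 2 <= influence S v A.
Proof.
move=> ul; pose c x := cov gibbs S (ind v) (ind x) A.
have c0 x : 0 <= c x by exact: cov_ind_ge0 Pp gibbs_lsm _ _ _ _.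
have layer r : (r <= l)%N -> c u ^+ 2 <= \sum_(x in ball N v r.+1 :\: ball N v r) c x.
  move=> rl; pose X := S :|: ~: ball N v r.
  have uX : u \in X.
    by rewrite !inE; apply/orP; right; apply: contra ul; apply/subsetP/ball_le.
  (* As [u] lies in [X], the spin of [v] may be replaced by its conditional expectation given [X].
     The variance of the latter dominates the squared covariance and, by the Markov property, is
     bounded by the covariances with the sphere. *)
  rewrite /c (cov_tower Pp (ind v) A (subsetUl S _) (ind_meas uX)).
  apply: le_trans (cov_sqr_le_var Pp _ _ _ _) _.
  apply: (var_cexp_le_sum Pp gibbs_lsm); first exact: subsetUl.
  exact: (@markov_ball _ _ _ N w partition_sum^-1 Pp S v r).
have layers m : (m <= l)%N -> m%:R * c u ^+ 2 <= \sum_(x in ball N v m) c x.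
  elim: m => [|m IH] ml; first by rewrite mul0r; apply: sumr_ge0 => x _; exact: c0.
  rewrite (big_setID (ball N v m)) /= (setIidPr (ballS N v m)) -[m.+1]addn1 natrD mulrDl mul1r.
  by apply: lerD; [exact/IH/ltnW|exact/layer/ltnW].
rewrite influenceE; apply: le_trans (layers l (leqnn l)) _.
rewrite [leRHS](bigID (fun x => x \in ball N v l)) /= lerDl.
by apply: sumr_ge0 => x _; exact: c0.
Qed.

Definition info_const : R := (1 + flip_ratio) ^+ 4.

Lemma info_const_ge0 : 0 <= info_const.
Proof. by apply: exprn_ge0; apply: addr_ge0 => //; exact/ltW/flip_ratio_gt0. Qed.

(** A far covariance [c] satisfies [c <= kap + c ^+ 2 / kap], and [cov_far] bounds [c ^+ 2] by the
    influence over [l]. The sum of the squares is thus small relative to the squared influence once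
    [kap] is small and then [l] is large. *)
Lemma minfo_far l S v (kap : R) : (0 < l)%N -> 0 < kap ->
  \sum_(u | u \notin ball N v l) minfo S v u <=
  info_const * (kap + (kap + (l%:R * kap)^-1) * 'E (fun A => influence S v A ^+ 2)).
Proof.
move=> l0 kap0; have l0' : 0 < l%:R :> R by rewrite ltr0n.
apply: (@le_trans _ _ (\sum_(u | u \notin ball N v l)
    info_const * 'E (fun A => cov gibbs S (ind v) (ind u) A ^+ 2))).
  apply: ler_sum => u ul; apply: (mutual_info_le_cov Pp P1 flip_ratio_gt0 gibbs_flip).
  by apply: contraNneq ul => ->; exact: ball_center.
rewrite -mulr_sumr ler_wpM2l ?info_const_ge0// -expect_sum//.
rewrite -expectZ// -{1}(expect_cst Pp P1 kap) -expectD//; apply: expect_le => // A.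
set chi := influence S v A; pose c x := cov gibbs S (ind v) (ind x) A.
have c0 x : 0 <= c x by exact: cov_ind_ge0 Pp gibbs_lsm _ _ _ _.
have chiE : chi = \sum_u c u by exact: influenceE.
apply: (@le_trans _ _ ((kap + chi / (l%:R * kap)) * chi)); last first.
  have : 0 <= kap * (1 - chi + chi ^+ 2) by rewrite mulr_ge0 ?(ltW kap0)//; nra.
  by rewrite mulrDl -mulrA [(_ * _)^-1 * chi]mulrC mulrA -expr2; lra.
apply: (@le_trans _ _ (\sum_(u | u \notin ball N v l) (kap + chi / (l%:R * kap)) * c u)).
  apply: ler_sum => u ul; have cu := c0 u; have lc := cov_far S A ul.
  rewrite -/chi -/(c u) in lc *.
  have h : c u ^+ 2 / kap <= chi / (l%:R * kap).
    by rewrite invfM mulrA ler_pM2r ?invr_gt0// ler_pdivlMr// mulrC.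
  have h2 : c u <= kap + c u ^+ 2 / kap.
    have -> : kap + c u ^+ 2 / kap = c u + ((c u - kap) ^+ 2 + c u * kap) / kap.
      by field; rewrite gt_eqF.
    by rewrite lerDl divr_ge0 ?(ltW kap0)// addr_ge0 ?sqr_ge0// mulr_ge0// ltW.
  by rewrite expr2 ler_wpM2r//; lra.
have chi0 : 0 <= chi by rewrite chiE; apply: sumr_ge0 => x _; exact: c0.
rewrite -mulr_sumr ler_wpM2l//.
  by rewrite addr_ge0 ?(ltW kap0)// divr_ge0// mulr_ge0 ?ltW.
by rewrite chiE [leRHS](bigID (fun u => u \notin ball N v l)) /= lerDl; apply: sumr_ge0 => x _; exact: c0.
Qed.

(* The potential bethe_excess + c1 * (total variance) grows by at most c2 at each
   reveal: the drop of the variance pays for the far mutual informations. *)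
Lemma bethe_excess_sampled l (kap : R) j0 M :
  tree_like N l -> (0 < l)%N -> 0 < kap -> (0 < j0)%N ->
  - sample_mean j0 (fun s => bethe_excess (seen s)) <=
  d%:R * ln 2 * (#|T|%:R / (1 + M%:R)) +
  (d%:R - 1) * info_const * (kap + (l%:R * kap)^-1) * (#|T|%:R ^+ 2 / j0%:R) +
  (M * #|T|)%:R * ((d%:R - 1) * info_const * kap).
Proof.
move=> tl l0 kap0 j0p; have n0 : 0 < #|T|%:R :> R by rewrite ltr0n.
have l0' : 0 < l%:R :> R by rewrite ltr0n.
set c1 := (d%:R - 1) * info_const * (kap + (l%:R * kap)^-1).
set c2 := (d%:R - 1) * info_const * kap.
have c10 : 0 <= c1.
  apply: mulr_ge0; first exact: mulr_ge0 d1 info_const_ge0.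
  by rewrite addr_ge0 ?(ltW kap0)// invr_ge0 mulr_ge0 ?ltW.
pose Vt S := 'E (cov gibbs S (total (R := R)) (total (R := R))).
pose Psi S := bethe_excess S + c1 * Vt S.
have drift S v : Psi (v |: S) <= Psi S + c2.
  have h1 := bethe_excess_drop S v tl.
  have h2 := ler_wpM2l d1 (minfo_far S v l0 kap0).
  have h3 := ler_wpM2l c10 (expect_var_step Pp P1 S (total (R := R)) v).
  have h4 : 'E (fun A => cov gibbs S (total (R := R)) (ind v) A ^+ 2) =
      'E (fun A => influence S v A ^+ 2).
    by apply: expect_ext => A; rewrite /influence cov_sym.
  rewrite h4 in h3.
  have h5 : (d%:R - 1) * (info_const *
      (kap + (kap + (l%:R * kap)^-1) * 'E (fun A => influence S v A ^+ 2))) =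
      c2 + c1 * 'E (fun A => influence S v A ^+ 2) by rewrite /c1 /c2; ring.
  rewrite h5 in h2; rewrite /Psi /Vt; lra.
have drift' S : mean (fun v => Psi (v |: S)) <= Psi S + c2.
  by rewrite -[leRHS](mean_cst T_gt0); apply: mean_le => // v; exact: drift.
have := sample_drift T_gt0 j0 (M * #|T|) drift'.
set J := (M * #|T| + j0)%N => hd.
(* At the end of the reveals at most [n / (1 + M)] vertices are unseen on average, where [n] is the
   number of vertices, so [bethe_excess_lb] is nearly zero per vertex. *)
have hJ : - (d%:R * ln 2 * (#|T|%:R / (1 + M%:R))) <= sample_mean J (fun s => Psi (seen s)).
  have Mp : 0 < 1 + M%:R :> R by rewrite ltr_pwDl ?ltr01 ?ler0n.
  have := sample_unseen (R := R) T_gt0 J; set q := sample_mean J _ => hq.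
  have q0 : 0 <= q.
    rewrite -(sample_mean_cst T_gt0 J 0); apply: sample_mean_le => // s _; exact: ler0n.
  have qb : q <= #|T|%:R / (1 + M%:R).
    rewrite ler_pdivlMr//; apply: le_trans hq; rewrite ler_wpM2l// lerD2l.
    by rewrite ler_pdivlMr// -natrM ler_nat leq_addr.
  have dl : 0 <= d%:R * ln 2 :> R by rewrite mulr_ge0 ?ler0n// ltW// ln_gt0// ltr1n.
  apply: (@le_trans _ _ (- (d%:R * ln 2) * q)).
    by rewrite mulNr lerN2 ler_wpM2l.
  rewrite -sample_meanZ; apply: sample_mean_le => // s _.
  have := bethe_excess_lb (seen s); rewrite /Psi mulNr => h; apply: le_trans h _.
  rewrite lerDl mulr_ge0// /Vt -(expect_cst Pp P1 0); apply: expect_le => // A.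
  exact: var_ge0.
have hV := sample_total_variance T_gt0 Pp P1 j0p.
have := ler_wpM2l c10 hV.
have -> : sample_mean j0 (fun s => bethe_excess (seen s)) =
    sample_mean j0 (fun s => Psi (seen s)) - c1 * sample_mean j0 (fun s => Vt (seen s)).
  by rewrite /Psi sample_meanD sample_meanZ; ring.
rewrite -/(Vt _); lra.
Qed.

Definition bethe_density (s t : R) : R :=
  d%:R / k%:R * (ln (factor_pf k w t) - k%:R * t * s) - (d%:R - 1) * entropy2 s.

(** Each vertex receives the field chosen for its own conditional probability. [gibbs_variational]
    and homogenization turn every factor into a sum over its vertices, and collecting the [d]
    factors at a vertex yields [bethe_density] there. *)
Lemma bethe_entropy_le S (M : R) (field : R -> R) :
  (forall s : R, 0 < s < 1 -> bethe_density s (field s) <= M) ->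
  bethe_entropy S + 'E (fun A => ln (weight A)) <=
  #|~: S|%:R * M + #|S|%:R * (d%:R / k%:R * ln (factor_pf k w 0)).
Proof.
move=> hM; have k0 : (0 < k)%N by exact: ltnW.
have kR : k%:R != 0 :> R by rewrite pnatr_eq0 -lt0n.
(* A revealed spin has conditional probability 0 or 1, outside the range of [hM]; it gets field 0
   and costs a constant. *)
pose th v A := if v \in S then 0 else field (cexp gibbs S (ind v) A).
have thm v : measurable_wrt S (th v).
  by move=> A B AB; rewrite /th (cexp_meas _ _ AB).
pose g v A := k%:R^-1 * ln (factor_pf k w (th v A)) - th v A * cexp gibbs S (ind v) A.
have factor f : H (N f :|: S) - H S + 'E (fun A => ln (w #|A :&: N f|)) <=
    'E (fun A => \sum_(v in N f) g v A).
  have := gibbs_variational (factor_size f) w_lc Pp P1 thm.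
  rewrite -lerBrDr => h; apply: le_trans h _; rewrite -expectB//; apply: expect_le => // A.
  rewrite /g sumrB lerD2r -mulr_sumr mulrC ler_pdivlMr ?ltr0n// mulrC.
  exact: local_pf_homogenize.
have lnW : 'E (fun A => ln (weight A)) = \sum_f 'E (fun A => ln (w #|A :&: N f|)).
  rewrite -expect_sum//; apply: expect_ext => A; rewrite /weight.
  have : forall r : seq F, ln (\prod_(f <- r) w #|A :&: N f|) = \sum_(f <- r) ln (w #|A :&: N f|).
    elim=> [|f r IH]; first by rewrite !big_nil ln1.
    rewrite !big_cons ln_prod_pos ?IH ?w_factor_gt0//.
    by apply: prodr_gt0 => f' _; exact: w_factor_gt0.
  exact.
have -> : bethe_entropy S + 'E (fun A => ln (weight A)) =
    \sum_f (H (N f :|: S) - H S + 'E (fun A => ln (w #|A :&: N f|))) -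
    (d%:R - 1) * \sum_v Hc v S.
  by rewrite big_split /= lnW /bethe_entropy; ring.
have swap : \sum_f 'E (fun A => \sum_(v in N f) g v A) = \sum_v d%:R * 'E (g v).
  under eq_bigr do rewrite expect_sum//.
  rewrite (exchange_big_dep predT)//=; apply: eq_bigr => v _.
  rewrite sumr_const mulr_natl -(degree v); congr (_ *+ _).
  by apply: eq_card => f; rewrite inE.
apply: (@le_trans _ _ (\sum_v (d%:R * 'E (g v) - (d%:R - 1) * Hc v S))).
  rewrite [leRHS]sumrB -[X in _ <= _ - X]mulr_sumr lerD2r -swap.
  by apply: ler_sum => f _; exact: factor.
rewrite (bigID (fun v => v \in S)) /= addrC; apply: lerD.
  rewrite -sum1_card natr_sum mulr_suml [leRHS](eq_bigl (fun v => v \notin S)); last first.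
    by move=> v; rewrite inE.
  apply: ler_sum => v vS; rewrite mul1r -(expect_cst Pp P1 M) centropyE// -!expectZ// -expectB//.
  apply: expect_le => // A.
  have s01 : 0 < cexp gibbs S (ind v) A < 1 by rewrite cexp_ind_gt0 ?cexp_ind_lt1.
  apply: le_trans (hM _ s01); rewrite /bethe_density /g /th (negbTE vS).
  rewrite le_eqVlt; apply/orP; left; apply/eqP; field; exact: kR.
rewrite -sum1_card natr_sum mulr_suml; apply: ler_sum => v vS.
rewrite mul1r centropy_mem// mulr0 subr0 -(expect_cst Pp P1 (d%:R / k%:R * _)) -expectZ//.
apply: expect_le => // A; rewrite /g /th vS mul0r subr0.
by rewrite mulrA.
Qed.

(* j0 is the size of the sample revealed at the start, (m * #|T|) the number of
   further reveals. *)
Lemma ln_partition_sum_le l (kap M : R) (field : R -> R) j0 m :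
  tree_like N l -> (0 < l)%N -> 0 < kap -> (0 < j0)%N ->
  (forall s : R, 0 < s < 1 -> bethe_density s (field s) <= M) ->
  ln partition_sum <= #|T|%:R * M + j0%:R * (ln 2 + `|d%:R / k%:R * ln (factor_pf k w 0) - M|) +
    d%:R * ln 2 * (#|T|%:R / (1 + m%:R)) +
    (d%:R - 1) * info_const * (kap + (l%:R * kap)^-1) * (#|T|%:R ^+ 2 / j0%:R) +
    (m * #|T|)%:R * ((d%:R - 1) * info_const * kap).
Proof.
move=> tl l0 kap0 j0p hM.
set C0 := d%:R / k%:R * ln (factor_pf k w 0).
(* The true entropy given the sample is the Bethe entropy minus the excess, and the sample itself
   has entropy at most [j0 * ln 2]. *)
have step s : size s = j0 -> ln partition_sum <= #|T|%:R * M + j0%:R * (ln 2 + `|C0 - M|) +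
    (-1) * bethe_excess (seen s).
  move=> sj; have := bethe_entropy_le (seen s) hM; rewrite -/C0 => hB.
  have cS : (#|seen s| <= j0)%N.
    by rewrite -sj /seen cardsE; exact: card_size.
  have cS' : #|seen s|%:R <= j0%:R :> R by rewrite ler_nat.
  have hH := entropy_setU_le Pp P1 set0 (seen s).
  rewrite setU0 entropy_set0// add0r in hH.
  have hH' : #|seen s|%:R * ln 2 <= j0%:R * ln 2 :> R.
    by rewrite ler_wpM2r// ltW// ln_gt0// ltr1n.
  have cC : #|~: seen s|%:R = #|T|%:R - #|seen s|%:R :> R.
    by rewrite -(cardsC (seen s)) natrD addrC addKr.
  have hM' : #|seen s|%:R * (C0 - M) <= j0%:R * `|C0 - M|.
    apply: (@le_trans _ _ (#|seen s|%:R * `|C0 - M|)); last by rewrite ler_wpM2r.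
    by rewrite ler_wpM2l ?ler_norm.
  rewrite cC in hB; rewrite ln_partition_sum /bethe_excess; lra.
have h : ln partition_sum <= sample_mean j0 (fun s => #|T|%:R * M + j0%:R * (ln 2 + `|C0 - M|) +
    (-1) * bethe_excess (seen s)).
  by rewrite -[leLHS](sample_mean_cst T_gt0 j0); exact: sample_mean_le.
rewrite sample_meanD sample_mean_cst// sample_meanZ in h.
have := bethe_excess_sampled m tl l0 kap0 j0p; lra.
Qed.

End UpperBound.

(** * The Bethe free energy *)

Section BetheFreeEnergy.
Context {R : realType}.
Context (w : nat -> R) (d k : nat).
Context (d_ge2 : (2 <= d)%N).
Context (k_ge2 : (2 <= k)%N).
Context (w_lc : log_convex_upto k w).

(* sup bethe_values is the supremum over s of the infimum over t of
   bethe_density. *)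
Definition bethe_values : classical_sets.set R := fun c =>
  exists2 s : R, 0 < s < 1 & forall t, c <= bethe_density w d k s t.

Definition bethe_free_energy : R := sup bethe_values.

Let dk_gt0 : 0 < d%:R / k%:R :> R.
Proof. by rewrite divr_gt0 ?ltr0n// ltnW. Qed.

Lemma factor_pf_ge_ends t : w 0 + w k * expR (k%:R * t) <= factor_pf k w t.
Proof.
have k0 : (0 < k)%N by exact: ltnW.
have nn (i : 'I_k.+1) : 0 <= 'C(k, i)%:R * (w i * expR (i%:R * t)).
  by rewrite !mulr_ge0 ?expR_ge0// ltW// w_lc.1// -ltnS.
rewrite /factor_pf (bigD1 ord0)//= (bigD1 ord_max)/=; last first.
  by rewrite -val_eqE /= -lt0n.
rewrite bin0 binn !mul1r mul0r expR0 mulr1 lerD2l lerDl.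
by apply: sumr_ge0 => i _; exact: nn.
Qed.

Lemma bethe_values_has_ub : has_ubound bethe_values.
Proof.
exists (d%:R / k%:R * ln (factor_pf k w 0)) => c [s s01 h].
apply: le_trans (h 0) _; rewrite /bethe_density mulr0 mul0r subr0 gerBl mulr_ge0//.
  by rewrite subr_ge0 ler1n ltnW.
by apply: entropy2_ge0; case/andP: s01 => *; rewrite !ltW.
Qed.

(** At [s = 2^-1] the full configuration of a factor compensates [k * t * s] when [t >= 0], and the
    empty one suffices when [t < 0]. *)
Lemma bethe_values_nonempty : (bethe_values !=set0)%classic.
Proof.
have w0 : 0 < w 0%N by exact: w_lc.1.
have wk : 0 < w k by exact: w_lc.1.
pose m := Num.min (ln (w 0%N)) (ln (w k)).
exists (d%:R / k%:R * m - (d%:R - 1) * entropy2 2^-1), 2^-1; first by lra.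
move=> t; rewrite /bethe_density lerD2r ler_pM2l//.
have fp := factor_pf_ge_ends t.
have wke : 0 < w k * expR (k%:R * t) by rewrite mulr_gt0 ?expR_gt0.
have kR : 0 <= k%:R :> R by exact: ler0n.
have [t0|t0] := leP 0 t.
  have : ln (w k * expR (k%:R * t)) <= ln (factor_pf k w t).
    by apply: ln_le_mono => //; lra.
  rewrite ln_prod_pos ?expR_gt0// expRK => h.
  have : m <= ln (w k) by rewrite /m ge_min lexx orbT.
  have := mulr_ge0 kR t0; lra.
have : ln (w 0%N) <= ln (factor_pf k w t) by apply: ln_le_mono => //; lra.
have : m <= ln (w 0%N) by rewrite /m ge_min lexx.
have := mulr_ge0 kR (_ : 0 <= - t); rewrite oppr_ge0 mulrN => /(_ (ltW t0)); lra.
Qed.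

(** If no [t] worked for some [s], then [bethe_free_energy + e] would be one of the values whose
    supremum is [bethe_free_energy]. *)
Lemma near_optimal_field (e : R) : 0 < e ->
  exists field : R -> R, forall s : R, 0 < s < 1 ->
    bethe_density w d k s (field s) <= bethe_free_energy + e.
Proof.
move=> e0.
have [f hf] : {f : R -> R & forall s : R, 0 < s < 1 ->
    bethe_density w d k s (f s) <= bethe_free_energy + e}.
  apply: (@boolp.choice _ _ (fun s t : R => 0 < s < 1 ->
    bethe_density w d k s t <= bethe_free_energy + e)) => s.
  have [s01|_] := boolP (0 < s < 1); last by exists 0.
  apply: contrapT => /forallNP H.
  have : bethe_values (bethe_free_energy + e).
    exists s => // t; rewrite leNgt; apply/negP => ht; apply: (H t) => _; exact: ltW.
  by move=> /(ub_le_sup bethe_values_has_ub); rewrite -/bethe_free_energy; lra.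
by exists f.
Qed.

Section Graphs.
Context {T F : finType} (N : F -> {set T}).
Context (T_gt0 : (0 < #|T|)%N).
Context (degree : forall v, #|[set f | v \in N f]| = d).
Context (factor_size : forall f, #|N f| = k).

Lemma double_count : (#|F| * k = #|T| * d)%N.
Proof.
transitivity (\sum_f \sum_(v in N f) 1)%N.
  rewrite -sum_nat_const; apply: eq_bigr => f _; by rewrite sum1_card factor_size.
rewrite (exchange_big_dep predT)//= -sum_nat_const; apply: eq_bigr => v _.
by rewrite sum1_card -(degree v); apply: eq_card => f; rewrite !inE.
Qed.

Lemma bethe_free_energy_le : bethe_free_energy <= ln (partition_sum N w) / #|T|%:R.
Proof.
apply: ge_sup bethe_values_nonempty _ => c [s s01 hc].
have n0 : 0 < #|T|%:R :> R by rewrite ltr0n.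
have k0 : (0 < k)%N by exact: ltnW.
have kR : k%:R != 0 :> R by rewrite pnatr_eq0 -lt0n.
have dR : d%:R != 0 :> R by rewrite pnatr_eq0 -lt0n ltnW.
(* This [g] solves the density inequality of [hc] for [ln (factor_pf k w t)]; the double count of
   edges then returns exactly [c] per vertex. *)
pose g := k%:R / d%:R * (c + (d%:R - 1) * entropy2 s).
have hg t : g + k%:R * t * s <= ln (factor_pf k w t).
  rewrite -lerBrDr -(ler_pM2l dk_gt0) /g mulrA.
  have -> : d%:R / k%:R * (k%:R / d%:R) = 1 :> R by field; rewrite kR dR.
  by rewrite mul1r -lerBrDr; exact: hc.
have := partition_lower_bound s01 k0 factor_size w_lc hg.
rewrite -[X in _ <= X -> _]/(partition_sum N w) => h.
rewrite ler_pdivlMr// -[leLHS]expRK; apply: ln_le_mono; first exact: expR_gt0.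
apply: le_trans h; rewrite ler_expR le_eqVlt; apply/orP; left; apply/eqP.
have FT : #|F|%:R = #|T|%:R * d%:R / k%:R :> R.
  by apply: (mulIf kR); rewrite divfK// -!natrM double_count.
by rewrite FT /g; field; rewrite kR dR.
Qed.

End Graphs.

Lemma exists_small (a e : R) : 0 <= a -> 0 < e -> exists2 x : R, 0 < x & a * x <= e.
Proof.
move=> a0 e0; have a1 : 0 < a + 1 by lra.
exists (e / (a + 1)); first by rewrite divr_gt0.
by rewrite mulrA ler_pdivrMr// mulrC; nra.
Qed.

Lemma exists_large (a e : R) : 0 <= a -> 0 < e -> exists m : nat, a <= e * m.+1%:R.
Proof.
move=> a0 e0; exists (Num.truncn (a / e)).
have /truncn_itv/andP[_ h] : 0 <= a / e by rewrite divr_ge0// ltW.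
by rewrite mulrC -ler_pdivrMr// ltW.
Qed.

Lemma free_energy_upper (e : R) : 0 < e ->
  exists l : nat, forall (T F : finType) (N : F -> {set T}),
    (0 < #|T|)%N ->
    (forall v, #|[set f | v \in N f]| = d) -> (forall f, #|N f| = k) ->
    tree_like N l -> ln (partition_sum N w) / #|T|%:R <= bethe_free_energy + e.
Proof.
move=> e0; pose e' := e / 7; have e'0 : 0 < e' by rewrite divr_gt0.
have [field hM] := near_optimal_field e'0.
set M := bethe_free_energy + e' in hM.
pose Q : R := ln 2 + `|d%:R / k%:R * ln (factor_pf k w 0) - M|.
have ln2 : 0 <= ln 2 :> R by rewrite ltW// ln_gt0// ltr1n.
have Q0 : 0 <= Q by rewrite addr_ge0.
pose D := (d%:R - 1) * info_const w d k.
have D0 : 0 <= D.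
  apply: mulr_ge0; first by rewrite subr_ge0 ler1n ltnW.
  apply: exprn_ge0; apply: addr_ge0 => //; apply: exprn_ge0.
  by apply: mulr_ge0; apply: sumr_ge0 => i _; rewrite ?invr_ge0 ltW// w_lc.1// -ltnS.
(* Order of choice: the fraction [dl] of vertices sampled first, the number [m] of further rounds,
   the threshold [kap] depending on both, and last the radius. Each error is measured in units of
   [e' = e / 7]. *)
have [dl dl0 hdl] := exists_small Q0 e'0.
have [m hm] := exists_large (mulr_ge0 (ler0n R d) ln2) e'0.
have [kap kap0 hkap] := @exists_small (D / dl + m%:R * D) e'
  (addr_ge0 (divr_ge0 D0 (ltW dl0)) (mulr_ge0 (ler0n R m) D0)) e'0.
have [l1 hl1] := exists_large Q0 e'0.
have [l2 hl2] := exists_large (divr_ge0 D0 (ltW (mulr_gt0 dl0 kap0))) e'0.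
pose l := maxn l1.+1 l2.+1; exists l => T F N T0 deg fs tl.
have l0 : (0 < l)%N by rewrite leq_max.
have l0' : 0 < l%:R :> R by rewrite ltr0n.
have n0 : 0 < #|T|%:R :> R by rewrite ltr0n.
(* Balls of radius [l] have more than [l] vertices, so a large radius forces a large graph; this
   absorbs the rounding of [j0]. *)
have ln_ : l%:R <= #|T|%:R :> R.
  have /card_gt0P[v _] := T0; rewrite ler_nat.
  apply: leq_trans (max_card (mem (ball N v l))).
  exact/ltnW/(ball_card v tl d_ge2 k_ge2 deg fs).
pose j0 := (Num.truncn (dl * #|T|%:R)).+1.
have /truncn_itv/andP[hj1 hj2] : 0 <= dl * #|T|%:R by rewrite mulr_ge0// ltW.
have j0_gt0 : 0 < j0%:R :> R by rewrite ltr0n.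
have := ln_partition_sum_le d_ge2 k_ge2 T0 deg fs w_lc m tl l0 kap0 (isT : (0 < j0)%N) hM.
rewrite -/Q -/D => h.
have b1 : j0%:R * Q <= (2 * e') * #|T|%:R.
  have h1 : j0%:R <= dl * #|T|%:R + 1 by rewrite /j0 -addn1 natrD lerD2r.
  have h2 := ler_wpM2r Q0 h1.
  have h3 : Q <= e' * #|T|%:R.
    apply: le_trans hl1 _; rewrite ler_pM2l//; apply: le_trans ln_.
    by rewrite ler_nat leq_maxl.
  have h4 := ler_wpM2r (ltW n0) hdl; lra.
have b2 : d%:R * ln 2 * (#|T|%:R / (1 + m%:R)) <= e' * #|T|%:R.
  have m1 : 0 < 1 + m%:R :> R by rewrite ltr_pwDl.
  by rewrite mulrA ler_pdivrMr// [leRHS]mulrAC ler_pM2r// addrC natr1.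
have nj : #|T|%:R ^+ 2 / j0%:R <= #|T|%:R / dl.
  rewrite ler_pdivrMr// mulrAC ler_pdivlMr// expr2 -mulrA ler_pM2l//.
  by rewrite mulrC ltW.
have b3 : D * (kap + (l%:R * kap)^-1) * (#|T|%:R ^+ 2 / j0%:R) <=
    (D / dl * kap + e') * #|T|%:R.
  have c0 : 0 <= D * (kap + (l%:R * kap)^-1).
    by rewrite mulr_ge0// addr_ge0 ?(ltW kap0)// invr_ge0 mulr_ge0 ?ltW.
  apply: le_trans (ler_wpM2l c0 nj) _.
  have -> : D * (kap + (l%:R * kap)^-1) * (#|T|%:R / dl) =
      (D / dl * kap + D / (dl * kap) / l%:R) * #|T|%:R.
    by field; rewrite !gt_eqF.
  rewrite ler_pM2r// lerD2l ler_pdivrMr//; apply: le_trans hl2 _.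
  by rewrite ler_pM2l// ler_nat leq_maxr.
rewrite ler_pdivrMr//; apply: le_trans h _.
rewrite natrM.
have b4 := ler_wpM2r (ltW n0) hkap.
have ee : e = 7 * e' by rewrite /e'; field.
have en := mulr_gt0 e'0 n0.
have -> : #|T|%:R * M = bethe_free_energy * #|T|%:R + e' * #|T|%:R by rewrite /M; ring.
rewrite [X in _ <= X](_ : _ = bethe_free_energy * #|T|%:R + 7 * (e' * #|T|%:R)); last first.
  by rewrite {1}ee; ring.
lra.
Qed.

End BetheFreeEnergy.

(** * Translation from factor graphs to set families, and the limit *)

Lemma partition_functionE (R : realType) (h : nat -> R) (G : factor_graph) (beta : R) :
  partition_function h G beta = partition_sum (@fnbhd G) (fun i => expR (- beta * h i)).
Proof.
rewrite /partition_function /partition_sum.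
rewrite (reindex_onto (fun A : {set vnode G} => [ffun v => v \in A])
  (fun x : {ffun vnode G -> bool} => [set v | x v])) /=; last first.
  by move=> x _; apply/ffunP => v; rewrite ffunE inE.
apply: eq_big => [A|A _].
  by apply/eqP/setP => v; rewrite inE ffunE.
rewrite /energy /weight mulr_sumr expR_sum; apply: eq_bigr => f _.
congr (expR (_ * h _)); rewrite -sum1_card [RHS]big_mkcond [LHS]big_mkcond.
apply: eq_bigr => v _; rewrite ffunE in_setI andbC.
by case: (v \in fnbhd f); case: (v \in A).
Qed.

Lemma gibbs_weight_log_convex (R : realType) (k : nat) (h : nat -> R) (beta : R) :
  0 <= beta -> symmetric_concave k h ->
  log_convex_upto k (fun i => expR (- beta * h i)).
Proof.
move=> b0 [_ hc]; split=> [i _|i ik]; first exact: expR_gt0.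
rewrite -!expRD ler_expR -!mulrDr !mulNr lerN2 ler_wpM2l//.
have := hc i.+1; rewrite !subn1 addn1 /= => hci.
by have := hci ltac:(lia); lra.
Qed.

Local Open Scope classical_set_scope.
Local Open Scope ring_scope.

Theorem theorem1 (R : realType) (d k : nat) (h : nat -> R)
    (hd : (2 <= d)%N) (hk : (2 <= k)%N) (hh : symmetric_concave k h) :
  exists Phi : R -> R,
    forall G : nat -> factor_graph,
      (forall n : nat, biregular d k (G n)) ->
      large_girth R G ->
      forall beta : R, 0 <= beta ->
        free_energy_density h (G n) beta @[n --> \oo] --> Phi beta.
Proof.
exists (fun beta => bethe_free_energy (fun i => expR (- beta * h i)) d k).
move=> G Greg Ggirth beta beta0.
have w_lc := gibbs_weight_log_convex beta0 hh.
apply/cvgrPdist_le => e e0.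
have [l hl] := free_energy_upper hd hk w_lc e0.
(* Girth at least [4 * l + 9] means that all cycles are longer than [4 * l + 8], as
   [girth_tree_like] asks. *)
have /cvgeyPge/(_ (4 * l + 9)%N%:R) large := Ggirth.
apply: filterS large => n girth_n.
have [T0 deg fs] := Greg n.
have deg' v : #|[set f | v \in @fnbhd (G n) f]%SET| = d.
  by rewrite -(deg v); apply: eq_card => f; rewrite !inE.
have tl : tree_like (@fnbhd (G n)) l.
  apply: girth_tree_like => c cyc.
  have : (girth R (G n) <= (size c)%:R%:E)%E.
    by apply: ereal_inf_lbound; exists c.
  move=> /(le_trans girth_n); rewrite lee_fin ler_nat; lia.
rewrite /free_energy_density partition_functionE ler_distlC.
have lo := bethe_free_energy_le hd hk w_lc T0 deg' fs.
have up := hl _ _ _ T0 deg' fs tl.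
by apply/andP; split; [apply: le_trans lo; rewrite gerBl ltW|].
Qed.
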